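(* Let $X$ be an affine complex variety and let $f \in \mathcal{K}^0(X(\mathbb{C}))$. Then for every subvariety (Zariski closed, with its reduced structure) $V \subset X$, we have $$f_{|V(\mathbb{C})} \in \mathcal{K}^0(V(\mathbb{C})).$$
   Context: An affine complex variety is $X=\operatorname{Spec}(\mathbb{C}[X])$ with $\mathbb{C}[X]$ a reduced finitely generated $\mathbb{C}$-algebra ($X$ need not be irreducible). $X(\mathbb{C})$ is the set of closed points of $X$, identified with a Zariski closed subset of some $\mathbb{C}^n$. A function $f:X(\mathbb{C})\to\mathbb{C}$ is rational if it is regular on some Zariski dense Zariski open subset of $X(\mathbb{C})$. $\mathcal{K}^0(X(\mathbb{C}))$ is the ring of functions $f:X(\mathbb{C})\to\mathbb{C}$ that are rational and continuous on all of $X(\mathbb{C})$ for the Euclidean topology. The same definitions apply to $V$. *)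

(* Defs.v *)
From HB Require Import structures.
From mathcomp Require Import all_boot all_order all_algebra.
From mathcomp Require Import all_classical all_reals all_analysis.
From mathcomp Require Import complex.
(* Not imported: its notations clash with those of MathComp-Analysis. *)
From mathcomp Require mpoly.

Set Implicit Arguments.
Unset Strict Implicit.
Unset Printing Implicit Defensive.

Import Order.TTheory GRing.Theory Num.Theory.
Import numFieldNormedType.Exports.

Local Open Scope classical_set_scope.
Local Open Scope ring_scope.

(* An affine variety is given by the set [X] of its closed points, a Zariski
   closed subset of affine n-space. A complex-valued function on it is a
   function on the subtype [set_type X], into which a set coerces.

   The definitions are stated over a [numClosedFieldType] [K], because it is on
   such abstract structures that the norm topology is found; they are meant for
   [K := R[i]] with [R : realType], that is, for the complex numbers. *)
Section AffineVarieties.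
Context {K : numClosedFieldType} {n : nat}.
Implicit Types (X : set 'rV[K]_n) (S : set (mpoly.mpoly n K)).

Definition peval (p : mpoly.mpoly n K) (x : 'rV[K]_n) : K :=
  mpoly.meval (fun i => x ord0 i) p.

Definition zero_locus S : set 'rV[K]_n :=
  [set x | forall p, S p -> peval p x = 0].

Definition zariski_closed X : Prop := exists S, X = zero_locus S.

(* [U] is open for the Zariski topology of [X], the one induced by K^n. *)
Definition zariski_open_in X (U : set X) : Prop :=
  exists2 Z : set 'rV[K]_n, zariski_closed Z & U = set_val @^-1` (~` Z).

Definition zariski_dense_in X (U : set X) : Prop :=
  forall W : set X, zariski_open_in W -> W !=set0 -> (U `&` W) !=set0.

(* Locally for the Zariski topology, [f] is a quotient of polynomials. *)
Definition regular_on X (U : set X) (f : X -> K) : Prop :=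
  forall x, U x -> exists W : set X,
    [/\ zariski_open_in W, W x, W `<=` U &
      exists p q : mpoly.mpoly n K, forall y, W y ->
        peval q (set_val y) != 0 /\
        f y = peval p (set_val y) / peval q (set_val y)].

Definition rational_function X (f : X -> K) : Prop :=
  exists U : set X,
    [/\ zariski_open_in U, zariski_dense_in U & regular_on U f].

(* K^0(X): here [continuous] is for the norm topology of K and for the topology
   that X inherits from the product topology of K^n. *)
Definition K0 X : set (X -> K) :=
  [set f | rational_function f /\ continuous f].

End AffineVarieties.

Arguments K0 {K n} X.

(* Main.v *)
(* Let [f] be continuous and rational on [X]. A Zariski locally closed set is
   dense, for the norm topology, in its Zariski closure. Applied to the domain
   of regularity [U] of [f] and to the graph of [f] over [U], this shows that
   the graph of [f] is Zariski closed in [X * K]: a point of the Zariski closure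
   of the graph over [U] is a limit of points of that graph, hence lies on the
   graph by continuity. So the graph of the restriction of [f] to [V] is Zariski
   closed too, and it remains to see that a function [g] with such a graph is
   rational. On a nonempty open subset of [V], take a relation
   [a_m(x) t ^ m + ... + a_0(x)] of minimal degree satisfied by [t = g x]. Every
   other relation is, generically, a multiple of it, and the relations have
   [g x] as their only common root, so this one is [a_m(x) (t - g x) ^ m]; in
   characteristic 0 this gives [g = - a_(m-1) / (m a_m)].

   The density statement reduces to a prime ideal of [K[x_1, ..., x_n]], and by
   Noether normalization to an integral extension [A] of [K[y_1, ..., y_d]].
   Choose a linear form that separates the given point from the other points
   of a finite grid containing its fibre. Since [K[y]] is integrally closed, the
   minimal polynomial of this form is monic over [K[y]], so that its roots move
   continuously with [y], and by lying over they lift to points of [A]. *)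
From HB Require Import structures.
Require Import Defs.
From mathcomp Require Import all_boot all_order all_algebra.
From mathcomp Require Import boolp classical_sets functions.
From mathcomp Require Import ring_quotient ring.
From mathcomp Require mpoly.

Module SeparatedGraphs.

Import mpoly.
Import Order.TTheory GRing.Theory Num.Theory.

Set Implicit Arguments.
Unset Strict Implicit.
Unset Printing Implicit Defensive.

Local Open Scope ring_scope.

Local Notation widen := (widen_ord (leqnSn _)).

(** * Gauss's lemma *)

(* Gauss's lemma for [D]: if [G] divides the monic polynomial [P] over the
   fraction field of [D], then [G / lead_coef G] has its coefficients in [D]. *)
Definition gauss_property (D : idomainType) :=
  forall (al : D) (P G B : {poly D}), al != 0 -> P \is monic ->
    al%:P * P = G * B -> forall j, exists c, G`_j = lead_coef G * c.

Lemma map_horner_eval_eq0 (F : fieldType) (s : F) (G : {poly {poly F}}) :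
  map_poly (horner_eval s) G = 0 -> exists G', G = ('X - s%:P)%:P * G'.
Proof.
move=> G0; exists (map_poly (fun p => p %/ ('X - s%:P)) G).
apply/polyP=> j; rewrite coefCM coef_map_id0 ?div0p //.
rewrite mulrC divpK // dvdp_XsubCl /root.
by have /polyP/(_ j) := G0; rewrite coef_map coef0 /= /horner_eval => ->.
Qed.

(** Induction on the size of [al]. If [al] is constant, [lead_coef G] is a unit. Otherwise [G * B]
    vanishes at a root [s] of [al]; the coefficients being evaluated in the field [F], ['X - s]
    divides all those of [G] or all those of [B] and can be cancelled. *)
Lemma gauss_poly (F : closedFieldType) : gauss_property {poly F}.
Proof.
move=> al; elim: {al}(size al) {-2}al (leqnn (size al)) => [|k IH] al.
  by rewrite leqn0 size_poly_eq0 => /eqP -> P G B; rewrite eqxx.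
move=> szal P G B al0 Pm E j.
have lcE : al = lead_coef G * lead_coef B.
  by rewrite -lead_coefM -E lead_coefM lead_coefC (monicP Pm) mulr1.
have [/size_poly1P[a a0 alE]|] := boolP (size al == 1).
  exists (lead_coef B * (a^-1)%:P * G`_j).
  by rewrite !mulrA -lcE alE -polyCM mulfV // mul1r.
move=> /(closed_rootP al)[s /factor_theorem[al' alE]].
have al'0 : al' != 0 by apply: contraNneq al0 => z; rewrite alE z mul0r.
have szal' : (size al' <= k)%N.
  by move: szal; rewrite alE size_Mmonic ?monicXsubC // size_XsubC addn2.
have Xs0 : ('X - s%:P)%:P != 0 :> {poly {poly F}}.
  by rewrite polyC_eq0 polyXsubC_eq0.
have: map_poly (horner_eval s) G * map_poly (horner_eval s) B = 0.
  rewrite -rmorphM -E rmorphM /= map_polyC /= /horner_eval alE.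
  by rewrite hornerM hornerXsubC subrr mulr0 polyC0 mul0r.
move/eqP; rewrite mulf_eq0 => /orP[] /eqP /map_horner_eval_eq0[G' GE].
  have E' : al'%:P * P = G' * B.
    apply: (mulfI Xs0); rewrite !mulrA -GE -E alE.
    by rewrite [in RHS]polyCM; ring.
  have [c cE] := IH _ szal' _ _ _ al'0 Pm E' j.
  by exists c; rewrite GE lead_coefM lead_coefC coefCM cE mulrA.
have E' : al'%:P * P = G * G'.
  apply: (mulfI Xs0); rewrite [RHS]mulrCA -GE -E alE.
  by rewrite [in RHS]polyCM; ring.
exact: IH _ szal' _ _ _ al'0 Pm E' j.
Qed.

Lemma gauss_property_iso (D1 D2 : idomainType) (f : {rmorphism D1 -> D2}) :
  bijective f -> gauss_property D2 -> gauss_property D1.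
Proof.
move=> [g fK gK] gaussD2 al P G B al0 Pm E j.
have finj := can_inj fK.
have [|||c cE] := gaussD2 (f al) (map_poly f P) (map_poly f G) (map_poly f B) _ _
  _ j.
- by rewrite raddf_eq0.
- by rewrite monicE lead_coef_map_inj ?rmorph0 // (monicP Pm) rmorph1.
- by rewrite -!rmorphM -E rmorphM /= map_polyC.
exists (g c); apply: (can_inj fK); rewrite rmorphM gK.
by move: cE; rewrite coef_map lead_coef_map_inj ?rmorph0.
Qed.

Section Euclid.
Variable K : numClosedFieldType.

Lemma poly_neq0_nonroot (D : idomainType) (f : {rmorphism K -> D})
  (p : {poly D}) : p != 0 -> exists s : K, p.[f s] != 0.
Proof.
move=> p0; apply: contrapT => /forallNP h.
pose rs := [seq f i%:R | i <- iota 0 (size p)].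
suff : (size rs < size p)%N by rewrite size_map size_iota ltnn.
apply: max_poly_roots => //.
  apply/allP => _ /mapP[i _ ->]; apply/negPn/negP => pi.
  exact: h pi.
rewrite map_inj_uniq ?iota_uniq // => i j /fmorph_inj /eqP.
by rewrite eqr_nat => /eqP.
Qed.

(* Divisibility of the coefficients is tested on values: divide by [X - s] and
   induct, so that no Vandermonde matrix is needed. *)
Lemma dvd_coef_horner (D : idomainType) (f : {rmorphism K -> D}) (b : D)
    (e p : {poly D}) : e != 0 ->
  (forall s, e.[f s] != 0 -> exists c, p.[f s] = b * c) ->
  forall i, exists c, p`_i = b * c.
Proof.
elim: {p}(size p) {-2}p (leqnn (size p)) e => [|k IH] p szp e e0 h i.
  by exists 0; move: szp; rewrite leqn0 size_poly_eq0 mulr0 => /eqP ->;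
    rewrite coef0.
have [s es] := poly_neq0_nonroot f e0.
have [c pE] := h s es.
have /factor_theorem[q qE] : root (p - (b * c)%:P) (f s).
  by rewrite /root !hornerE pE subrr.
have {}pE : p = q * ('X - (f s)%:P) + (b * c)%:P by rewrite -qE subrK.
have szq : (size q <= k)%N.
  have [->|q0] := eqVneq q 0; first by rewrite size_poly0.
  rewrite -ltnS (leq_trans _ szp) // pE size_addl size_Mmonic ?monicXsubC //.
    by rewrite size_XsubC addn2.
  rewrite size_XsubC addn2 ltnS (leq_trans (size_polyC_leq1 _)) //.
  by rewrite lt0n size_poly_eq0.
have Xs0 : 'X - (f s)%:P != 0 by rewrite polyXsubC_eq0.
(* For [t != s], the value of [q] at [f t] is a difference of two values of [p] divided by [t - s],
   again a multiple of [b]. The factor added to [e] excludes [t = s]. *)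
have {}IH j : exists c, q`_j = b * c.
  apply: IH szq _ (mulf_neq0 e0 Xs0) _ j => t.
  rewrite hornerM mulf_eq0 negb_or hornerXsubC => /andP[et ts].
  have [c' c'E] := h t et.
  have ut : f (t - s)^-1 * (f t - f s) = 1.
    rewrite -rmorphB -rmorphM mulVf ?rmorph1 //.
    by apply: contraNneq ts => /subr0_eq ->; rewrite subrr.
  exists (f (t - s)^-1 * (c' - c)).
  by rewrite mulrCA mulrBr -c'E pE !hornerE addrK mulrCA ut mulr1.
have [c1 c1E] := IH i; have [c2 c2E] := IH i.-1.
exists ((if i == 0%N then 0 else c2) - c1 * f s + (if i == 0%N then c else 0)).
rewrite pE mulrBr coefD coefB coefMX coefMC coefC c1E c2E.
by case: (i == 0%N); ring.
Qed.


(* Evaluating the coefficients in [K] reduces to [gauss_poly] and shows that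
   [lead_coef G] divides [be * G`_j] for a constant [be] of [D]; evaluating the
   variable in [K] then reduces to [D] and gets rid of [be]. *)
Lemma gauss_property_poly (D : idomainType) (f : {rmorphism K -> D}) :
  (forall g : D, g != 0 -> exists phi : {rmorphism D -> K}, phi g != 0) ->
  gauss_property D -> gauss_property {poly D}.
Proof.
move=> nonroot gaussD al P G B al0 Pm E j.
have G0 : lead_coef G != 0.
  apply: contraNneq al0 => /eqP; rewrite lead_coef_eq0 => /eqP G0.
  have /eqP := E; rewrite G0 mul0r mulf_eq0 polyC_eq0 => /orP[//|/eqP P0].
  by move: Pm; rewrite P0 monicE lead_coef0 eq_sym oner_eq0.
set l := lead_coef G in G0 *; set g := G`_j.
have divE := Pdiv.Idomain.divp_eq g l; set be := _ ^+ _ in divE.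
have be0 : be != 0 by rewrite expf_neq0 // lead_coef_eq0.
set Q := g %/ l in divE; set r := g %% l in divE.
have r0 : r = 0.
  apply/eqP/negPn/negP => r0.
  (* Keeping these leading coefficients nonzero preserves the sizes of [l] and [r], so the image of
     [r] is too short to be a multiple of that of [l]. *)
  have [|phi] := nonroot (lead_coef al * lead_coef l * lead_coef r).
    by rewrite !mulf_neq0 1?lead_coef_eq0.
  rewrite !rmorphM /= !mulf_eq0 !negb_or => /andP[/andP[pal pl] pr].
  pose psi := map_poly phi.
  have nz (p : {poly D}) : phi (lead_coef p) != 0 -> psi p != 0.
    by move=> h; rewrite -lead_coef_eq0 lead_coef_map_eq.
  have psil := nz _ pl.
  have [|||c cE] := @gauss_poly K (psi al) (map_poly psi P) (map_poly psi G)
    (map_poly psi B) _ _ _ j; first exact: nz.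
  - exact: monic_map.
  - by rewrite -!rmorphM -E rmorphM /= map_polyC.
  have {}cE : psi g = psi l * c.
    by move: cE; rewrite coef_map lead_coef_map_eq.
  have : psi l %| psi r.
    have -> : r = be *: g - Q * l by rewrite divE addrC addKr.
    rewrite /psi rmorphB /= map_polyZ rmorphM /= -/psi cE.
    by rewrite dvdp_sub ?dvdp_mull // -mul_polyC dvdp_mull // dvdp_mulr.
  move/(dvdp_leq (nz _ pr)); apply/negP; rewrite -ltnNge.
  by rewrite !size_map_poly_id0 // ltn_modp.
rewrite r0 addr0 in divE.
(* Now [be * g = Q * l]. Where [al * l] is nonzero, Gauss's lemma in [D] makes the value of [g] a
   multiple of that of [l], so [be] divides the value of [Q]. *)
have Qdvd i : exists c, Q`_i = be * c.
  apply: (dvd_coef_horner (f := f) (mulf_neq0 al0 G0)) i => s.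
  rewrite hornerM mulf_eq0 negb_or => /andP[als ls].
  pose ev := horner_eval (f s).
  have [||c cE] := gaussD _ (map_poly ev P) (map_poly ev G) (map_poly ev B) als _
    _ j.
  - exact: monic_map.
  - by rewrite -!rmorphM -E rmorphM /= map_polyC.
  exists c; apply: (mulfI ls).
  move: cE; rewrite lead_coef_map_eq // coef_map /= -/g /ev /horner_eval => cE.
  by rewrite mulrC -hornerM -divE hornerZ cE; ring.
have {Qdvd}/choice[c cE] := Qdvd.
exists (\poly_(i < size Q) c i).
have -> : g = l * \poly_(i < size Q) c i; last by [].
apply: (mulfI (_ : be%:P != 0)); first by rewrite polyC_eq0.
rewrite mul_polyC divE mulrCA mulrC; congr (_ * _).
apply/polyP => i; rewrite mul_polyC coefZ coef_poly; case: ltnP => // h.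
by rewrite mulr0 nth_default.
Qed.

End Euclid.

(** * Polynomials in n + 1 variables as polynomials in the last one *)

Section MpolyUni.
Variables (R : idomainType) (n : nat).

Definition mmul (p : {poly {mpoly R[n]}}) : {mpoly R[n.+1]} :=
  (map_poly (@mwiden n R) p).['X_ord_max].

Lemma muniX m : muni 'X_[m] =
  'X_[[multinom m (widen i) | i < n]] *: 'X^(m ord_max) :> {poly {mpoly R[n]}}.
Proof. by rewrite muniE msuppX big_seq1 mcoeffX eqxx scale1r. Qed.

Lemma muniK : cancel (@muni n R) mmul.
Proof.
move=> p; rewrite muniE [RHS]mpolyE /mmul.
rewrite -[LHS]/(horner_eval _ (map_poly _ _)) !rmorph_sum /=.
apply: eq_bigr => m _; rewrite /horner_eval map_polyZ /= map_polyXn.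
rewrite hornerZ hornerXn mwidenZ mwidenX -scalerAl mpolyXn -mpolyXD.
congr (_ *: 'X_[_]); apply/mnmP => i; rewrite mnmDE mulmnE mnm1E.
have [->|i_max] := eqVneq i ord_max.
  by rewrite mnmwiden_ordmax mul1n.
have lt_in : (i < n)%N.
  by rewrite ltn_neqAle -ltnS ltn_ord andbT; apply: contraNneq i_max => e;
    apply/eqP/val_inj.
rewrite mul0n addn0 (_ : i = widen (Ordinal lt_in)); last exact: val_inj.
by rewrite mnmwiden_widen mnmE.
Qed.

Lemma mmulK : cancel mmul (@muni n R).
Proof.
have mwidenK q : muni (mwiden q) = q%:P :> {poly {mpoly R[n]}}.
  rewrite [in LHS](mpolyE q) [in RHS](mpolyE q) (raddf_sum polyC).
  rewrite (raddf_sum (@mwiden n R)) (raddf_sum (@muni n R)).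
  apply: eq_bigr => m _; rewrite -[LHS]/(muni (mwiden (q@_m *: 'X_[m]))).
  rewrite mwidenZ mwidenX muniZ muniX.
  rewrite mnmwiden_ordmax expr0 alg_polyC -mul_polyC -polyCM mul_mpolyC.
  congr (_ *: 'X_[_])%:P; apply/mnmP => i.
  by rewrite mnmE mnmwiden_widen.
move=> p; rewrite /mmul horner_coef -[RHS]coefK poly_def rmorph_sum /=.
have mwI : injective (@mwiden n R).
  by move=> q r /(congr1 (@muni n R)); rewrite !mwidenK => /polyC_inj.
rewrite (size_map_inj_poly mwI (mwiden0 _ _)).
apply: eq_bigr => i _; rewrite coef_map /= rmorphM /= mwidenK rmorphXn /=.
rewrite muniX mul_polyC; congr (_ *: _ ^+ _).
rewrite (_ : [multinom _ | _ < n] = 0%MM) ?mpolyX0 ?scale1r ?mnm1E ?eqxx //.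
apply/mnmP => k; rewrite mnmE mnm1E mnm0E; apply/eqP; rewrite eqb0.
by apply/negP => /eqP/(congr1 val)/= /eqP; rewrite gtn_eqF.
Qed.

Lemma muni_bij : bijective (@muni n R).
Proof. by exists mmul; [exact: muniK | exact: mmulK]. Qed.

Lemma meval_muni (v : 'I_n.+1 -> R) p :
  p.@[v] = (map_poly (meval (fun i => v (widen i))) (muni p)).[v ord_max].
Proof.
rewrite muniE -[RHS]/(horner_eval _ (map_poly _ _)) !rmorph_sum /=.
rewrite mevalE; apply: eq_bigr => m _.
rewrite /horner_eval map_polyZ /= map_polyXn hornerZ hornerXn mevalZ mevalX.
rewrite -mulrA big_ord_recr /=; congr (_ * (_ * _)).
by apply: eq_bigr => i _; rewrite mnmE.
Qed.

End MpolyUni.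

(** * Nonvanishing near a point, and Gauss's lemma in several variables *)

Section Points.
Variable K : numClosedFieldType.

Lemma near_poly_neq0 (p : {poly K}) (a e : K) : p != 0 -> 0 < e ->
  exists2 b, `|b - a| < e & p.[b] != 0.
Proof.
move=> p0 e0; apply: contrapT => h.
(* Denominators start at 2 to keep the distance to [a] strictly below [e]. *)
pose g i : K := a + e / i.+2%:R.
have ginj : injective g.
  move=> i j /addrI /(mulfI (lt0r_neq0 e0)) /invr_inj /eqP.
  by rewrite eqr_nat => /eqP[].
pose rs := [seq g i | i <- iota 0 (size p)].
suff : (size rs < size p)%N by rewrite size_map size_iota ltnn.
apply: max_poly_roots => //; last by rewrite map_inj_uniq ?iota_uniq.
apply/allP => _ /mapP[i _ ->]; apply/negPn/negP => pi.
apply: h; exists (g i) => //.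
rewrite /g addrC addKr normrM normfV normr_nat gtr0_norm //.
by rewrite ltr_pdivrMr ?ltr0n // ltr_pMr // ltr1n.
Qed.

(** Moving the first [n] coordinates keeps the leading coefficient of [muni p] nonzero; the last
    coordinate is then moved off the roots of a nonzero polynomial in one variable. *)
Lemma near_mpoly_neq0 n (p : {mpoly K[n]}) (a : 'I_n -> K) (e : K) :
  p != 0 -> 0 < e ->
  exists2 b : 'I_n -> K, forall i, `|b i - a i| < e & p.@[b] != 0.
Proof.
elim: n p a => [|n IH] p a p0 e0.
  exists a => [[]//|]; rewrite (nvar0_mpolyC p) mevalC.
  by apply: contraNneq p0 => p0; rewrite (nvar0_mpolyC p) p0.
have mp0 : muni p != 0 by rewrite raddf_eq0 //; exact: can_inj (@muniK _ _).
have [|b bP lb] := IH (lead_coef (muni p)) (fun i => a (widen i)) _ e0.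
  by rewrite lead_coef_eq0.
have [||c cP pc] := @near_poly_neq0 (map_poly (meval b) (muni p)) (a ord_max) e.
- by rewrite -lead_coef_eq0 lead_coef_map_eq.
- by [].
pose v (i : 'I_n.+1) := if unlift ord_max i is Some j then b j else c.
have vmax : v ord_max = c by rewrite /v unlift_none.
have vwiden i : v (widen i) = b i.
  rewrite /v (_ : widen i = lift ord_max i) ?liftK //.
  by apply: val_inj; rewrite /= /bump leqNgt ltn_ord.
exists v => [i|].
  rewrite /v; case: unliftP => [j ->|->] //.
  rewrite (_ : lift ord_max j = widen j) //.
  by apply: val_inj; rewrite /= /bump leqNgt ltn_ord.
rewrite meval_muni vmax; congr (_ != 0) : pc; congr (_.[_]).
by apply: eq_map_poly => q; apply: meval_eq.
Qed.

Lemma gauss_property_mpoly n : gauss_property {mpoly K[n]}.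
Proof.
elim: n => [|n IH].
  move=> al P G B al0 Pm E j.
  have lu : lead_coef G != 0.
    apply: contraNneq al0 => G0.
    have := congr1 lead_coef E.
    by rewrite !lead_coefM G0 mul0r lead_coefC (monicP Pm) mulr1 => ->.
  have := nvar0_mpolyC (lead_coef G); set l := _@_ _ => lE.
  exists ((l^-1)%:MP * G`_j); rewrite mulrA lE -mpolyCM mulfV ?mpolyC1 ?mul1r //.
  by apply: contraNneq lu => l0; rewrite lE l0.
apply: (gauss_property_iso (muni_bij _ _)).
apply: (@gauss_property_poly K _ (@mpolyC n K)) IH => g g0.
by have [v _] := near_mpoly_neq0 (fun=> 0) g0 ltr01; exists (meval v).
Qed.

End Points.

(** * Lying over *)

Section Companion.
Variables (R : comNzRingType) (n : nat) (f : {poly R}).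
Hypotheses (fm : f \is monic) (fn : size f = n.+2).

Definition companion_mx : 'M[R]_n.+1 :=
  \matrix_(i, j) if i == ord_max then - f`_j else (i.+1 == j :> nat)%:R.

Lemma companion_mx_eigen (a : R) : f.[a] = 0 ->
  companion_mx *m (\col_i a ^+ i) = a *: \col_i a ^+ i.
Proof.
move=> fa0; apply/colP => i; rewrite !mxE -exprS.
have [->|i_max] := eqVneq i ord_max.
  under eq_bigr do rewrite !mxE eqxx mulNr.
  rewrite sumrN; apply/eqP; rewrite eq_sym -addr_eq0 addrC.
  have := fa0; rewrite horner_coef fn big_ord_recr /= => e.
  apply/eqP; rewrite -[RHS]e.
  by have := monicP fm; rewrite lead_coefE fn /= => ->; rewrite mul1r.
have lt_in : (i.+1 < n.+1)%N.
  by rewrite ltn_neqAle ltn_ord andbT; apply: contraNneq i_max => - [e];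
    apply/eqP/val_inj.
rewrite (bigD1 (Ordinal lt_in)) //= big1 => [|k ki]; rewrite !mxE (negPf i_max).
  by rewrite eqxx mul1r addr0.
rewrite (_ : _ == _ = false) ?mul0r //.
by apply: contraNF ki => /eqP e; apply/eqP/val_inj.
Qed.

Lemma horner_companion (p : {poly R}) (a : R) : f.[a] = 0 ->
  horner_mx companion_mx p *m (\col_i a ^+ i) = p.[a] *: \col_i a ^+ i.
Proof.
move=> fa0; elim/poly_ind: p => [|p c IH].
  by rewrite rmorph0 mul0mx horner0 scale0r.
rewrite rmorphD rmorphM /= horner_mx_X horner_mx_C mulmxDl -mulmxA.
rewrite companion_mx_eigen // -scalemxAr IH mul_scalar_mx hornerMXaddC scalerDl.
by rewrite scalerA mulrC.
Qed.

(** Multiplying the eigenvector equation by the adjugate shows that the determinant kills the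
    eigenvector, whose entry of index 0 is [a ^+ 0 = 1]. *)
Lemma det_horner_companion (p : {poly R}) (a : R) : f.[a] = 0 -> p.[a] = 0 ->
  \det (horner_mx companion_mx p) = 0.
Proof.
move=> fa0 pa0; have := horner_companion p fa0.
rewrite pa0 scale0r => /(congr1 (mulmx (\adj (horner_mx companion_mx p)))).
rewrite mulmx0 mulmxA mul_adj_mx mul_scalar_mx => /colP/(_ ord0).
by rewrite !mxE /= expr0 mulr1.
Qed.

End Companion.

Lemma rpred_det (R : comNzRingType) (S : subringClosed R) n (M : 'M[R]_n) :
  M \is a mxOver S -> \det M \in S.
Proof.
move=> /mxOverP MS; rewrite rpred_sum // => s _.
by rewrite rpredM ?rpred_sign // rpred_prod.
Qed.

Lemma rpred_horner_mx (R : comNzRingType) (S : subringClosed R) n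
    (A : 'M[R]_n.+1) (p : {poly R}) :
  A \is a mxOver S -> p \is a polyOver S -> horner_mx A p \is a mxOver S.
Proof.
move=> AS pS; rewrite -[p]coefK poly_def rmorph_sum rpred_sum // => i _.
rewrite /= linearZ rmorphXn /= horner_mx_X mxOverZ ?(polyOverP pS) //.
elim: (i : nat) => [|k IH]; first by rewrite expr0 mxOver_scalar ?rpred0 ?rpred1.
by rewrite exprS mxOverM.
Qed.

(* A partial ring homomorphism from [L] to [K] is encoded by its graph, a
   subring of [L * K]. *)
Section PartialMorphism.
Variables (L : comNzRingType) (K : closedFieldType) (iota : {rmorphism K -> L}).
Local Notation LK := (L * K)%type.
Implicit Types H : subringClosed LK.

Definition functional H := forall c, (0, c) \in H -> c = 0.

Definition const_closed H := forall c, (iota c, c) \in H.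

Lemma functional_eq H l c d : functional H ->
  (l, c) \in H -> (l, d) \in H -> c = d.
Proof.
move=> Hf lc ld; apply: subr0_eq; apply: Hf.
by rewrite -(subrr l) -[(_, _)]/((l, c) - (l, d)) rpredB.
Qed.

Lemma horner_fst (p : {poly LK}) z : p.[z].1 = (map_poly fst p).[z.1].
Proof. by rewrite horner_map. Qed.

Lemma horner_snd (p : {poly LK}) z : p.[z].2 = (map_poly snd p).[z.2].
Proof. by rewrite horner_map. Qed.

Section Adjoin.
Variables (H : subringClosed LK) (z : LK).

Definition adjoin : {pred LK} :=
  [pred y | `[< exists2 p : {poly LK}, p \is a polyOver H & y = p.[z] >]].

Lemma adjoinP y :
  reflect (exists2 p : {poly LK}, p \is a polyOver H & y = p.[z]) (y \in adjoin).
Proof. exact: asboolP. Qed.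

Fact adjoin_subring_closed : subring_closed adjoin.
Proof.
split.
- by apply/adjoinP; exists 1; rewrite ?rpred1 // hornerC.
- move=> _ _ /adjoinP[p pH ->] /adjoinP[q qH ->]; apply/adjoinP.
  by exists (p - q); rewrite ?rpredB // hornerD hornerN.
- move=> _ _ /adjoinP[p pH ->] /adjoinP[q qH ->]; apply/adjoinP.
  by exists (p * q); rewrite ?rpredM // hornerM.
Qed.

HB.instance Definition _ := GRing.isSubringClosed.Build LK adjoin
  adjoin_subring_closed.

Lemma adjoin_sub : {subset H <= adjoin}.
Proof. by move=> y yH; apply/adjoinP; exists y%:P; rewrite ?polyOverC ?hornerC. Qed.

Lemma adjoin_gen : z \in adjoin.
Proof. by apply/adjoinP; exists 'X; rewrite ?polyOverX ?hornerX. Qed.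

Lemma functional_adjoin :
  (forall p, p \is a polyOver H ->
    (map_poly fst p).[z.1] = 0 -> (map_poly snd p).[z.2] = 0) ->
  functional adjoin.
Proof.
move=> h c /adjoinP[p pH e].
by have := h p pH; rewrite -horner_fst -horner_snd -e /=; apply.
Qed.

End Adjoin.

(* The value at the companion matrix of [f] of a relation [p] satisfied by [a]
   has the eigenvector of the powers of [a] for the eigenvalue 0 over [L], hence
   determinant 0, while over [K] it would be the identity. *)
Lemma no_unit_relation H (f p : {poly LK}) a : functional H ->
  f \is monic -> f \is a polyOver H -> p \is a polyOver H ->
  (map_poly fst f).[a] = 0 -> (map_poly fst p).[a] = 0 ->
  map_poly snd p <> 1.
Proof.
move=> Hf fm fH pH fa0 pa0 p1.
have f1m : map_poly fst f \is monic by rewrite monic_map.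
have szf1 : size (map_poly fst f) = size f.
  by rewrite size_map_poly_id0 // (monicP fm) oner_neq0.
case sz : (size f) => [|[|n]].
- by move/eqP: sz; rewrite size_poly_eq0 (negPf (monic_neq0 fm)).
- have /size_poly1P[c c0 fE] : size (map_poly fst f) == 1%N by rewrite szf1 sz.
  by move/eqP: fa0; rewrite fE hornerC (negPf c0).
pose A := companion_mx n f; pose M := horner_mx A p.
have AH : A \is a mxOver H.
  apply/mxOverP => i j; rewrite mxE; case: ifP => _; last exact: rpred_nat.
  by rewrite rpredN (polyOverP fH).
have MH : \det M \in H by apply/rpred_det/rpred_horner_mx.
have M1 : (\det M).1 = 0.
  rewrite -[LHS]/(fst (\det M)) -det_map_mx map_horner_mx.
  rewrite (_ : map_mx _ A = companion_mx n (map_poly fst f)).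
    by apply: det_horner_companion fa0 pa0 => //; rewrite szf1.
  apply/matrixP => i j; rewrite !mxE coef_map /=.
  by case: ifP => _; rewrite ?rmorphN // rmorph_nat.
have M2 : (\det M).2 = 1.
  by rewrite -[LHS]/(snd (\det M)) -det_map_mx map_horner_mx p1 rmorph1 det1.
have detM : \det M = (0, 1) by rewrite (surjective_pairing (\det M)) M1 M2.
by have := Hf 1; rewrite -detM => /(_ MH)/eqP; rewrite oner_eq0.
Qed.

(** The images in [{poly K}] of the relations of [a] over [H] form an ideal [I], proper by
    [no_unit_relation]. Its generator [g] has a root [w], and sending [a] to [w] respects every
    relation. *)
Lemma extend_integral H (f : {poly LK}) a : const_closed H -> functional H ->
  f \is monic -> f \is a polyOver H -> (map_poly fst f).[a] = 0 ->
  exists w, functional (adjoin H (a, w)).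
Proof.
move=> Hc Hf fm fH fa0.
pose I (q : {poly K}) := exists p : {poly LK},
  [/\ p \is a polyOver H, (map_poly fst p).[a] = 0 & map_poly snd p = q].
have f2m : map_poly snd f \is monic by rewrite monic_map.
have exI : exists k, `[< exists q, [/\ q != 0, I q & size q = k] >].
  exists (size (map_poly snd f)); apply/asboolP; exists (map_poly snd f).
  by split=> //; [exact: monic_neq0 | exists f].
have [k /asboolP[g [g0 Ig gk]] gmin] := ex_minnP exI.
(* Constants belong to [H], so every polynomial over [K] lifts to one over [H]; hence [I] is stable
   under multiples. *)
have lift (q : {poly K}) : exists2 p : {poly LK}, p \is a polyOver H & map_poly
  snd p = q.
  exists (map_poly (fun c => (iota c, c)) q).
    apply/polyOverP => i; rewrite coef_map_id0 //.
    by rewrite -[RHS]/(0, 0) rmorph0.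
  apply/polyP => i; rewrite coef_map coef_map_id0 //.
  by rewrite -[RHS]/(0, 0) rmorph0.
have IM q h : I h -> I (q * h).
  move=> [p [pH pa ph]]; have [p' p'H p'q] := lift q.
  exists (p' * p); rewrite rpredM // !rmorphM /= hornerM pa mulr0 p'q ph.
  by split.
have Idvd q : I q -> g %| q.
  move=> [p [pH pa pq]]; rewrite /dvdp; apply: contrapT => /negP r0.
  have /gmin : `[< exists q', [/\ q' != 0, I q' & size q' = size (q %% g)] >].
    apply/asboolP; exists (q %% g); split=> //.
    have [p' [p'H p'a p'q]] := IM (q %/ g) _ Ig.
    exists (p - p'); rewrite rpredB // !rmorphB /= hornerD hornerN pa p'a subrr.
    by split=> //; rewrite pq p'q {1}(divp_eq q g) addrC addKr.
  by rewrite leqNgt -gk ltn_modp g0.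
have : size g != 1%N.
  apply/negP => /size_poly1P[c c0 gE].
  have [p [pH pa p1]] := IM (c^-1)%:P _ Ig.
  apply: (no_unit_relation Hf fm fH pH fa0 pa).
  by rewrite p1 gE -polyCM mulVf.
move=> /(closed_rootP g)[w gw]; exists w; apply: functional_adjoin => p pH pa.
apply/eqP; rewrite -[_ == 0]/(root _ _) -dvdp_XsubCl /=.
by rewrite -dvdp_XsubCl in gw; apply: (dvdp_trans gw); apply: Idvd; exists p.
Qed.

End PartialMorphism.

(** A property rather than a structure, since the quotients by prime ideals used below are built as
    mere commutative rings. *)
Definition domain (A : comNzRingType) :=
  forall x y : A, x * y = 0 -> x = 0 \/ y = 0.

(** * Minimal polynomials of integral elements *)

Section MinimalPolynomial.
Variables (D : idomainType) (A : comNzRingType) (i : {rmorphism D -> A}).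
Hypotheses (Ad : domain A) (iinj : injective i) (gaussD : gauss_property D).

(** A nonzero relation [G] of least size divides a scalar multiple of the monic relation [P]; by
    Gauss's lemma, [G] is then its leading coefficient times a monic [M]. Remainders modulo [M] are
    relations too short to be nonzero. *)
Lemma integral_minpoly (a : A) : integralOver i a ->
  exists M : {poly D}, [/\ M \is monic, (map_poly i M).[a] = 0 &
    forall G, (map_poly i G).[a] = 0 -> exists Q, G = Q * M].
Proof.
move=> [P Pm /eqP Pa].
have exP : exists k, `[< exists G : {poly D},
    [/\ G != 0, (map_poly i G).[a] = 0 & size G = k] >].
  by exists (size P); apply/asboolP; exists P; rewrite monic_neq0.
have [k /asboolP[G [G0 Ga Gk]] kmin] := ex_minnP exP.
have small (r : {poly D}) : (map_poly i r).[a] = 0 -> (size r < k)%N -> r = 0.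
  move=> ra szr; apply: contraTeq szr => r0; rewrite -leqNgt.
  by apply: kmin; apply/asboolP; exists r.
have := Pdiv.Idomain.divp_eq P G; set al := _ ^+ _; set Q := P %/ G => divE.
have al0 : al != 0 by rewrite expf_neq0 // lead_coef_eq0.
have r0 : P %% G = 0.
  apply: small; last by rewrite -Gk ltn_modp.
  have -> : P %% G = al *: P - Q * G by rewrite divE addrC addKr.
  rewrite -mul_polyC rmorphB !rmorphM /= hornerD hornerN !hornerM.
  by rewrite Ga Pa !mulr0 subrr.
rewrite r0 addr0 -mul_polyC mulrC mulrC [Q * G]mulrC in divE.
have /choice[c cE] := gaussD al0 Pm divE.
pose M := \poly_(j < size G) c j.
have GE : G = lead_coef G *: M.
  apply/polyP => j; rewrite coefZ coef_poly; case: ltnP => h //.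
  by rewrite mulr0 nth_default.
have l0 : lead_coef G != 0 by rewrite lead_coef_eq0.
have Mm : M \is monic.
  apply/eqP; apply: (mulfI l0).
  by rewrite mulr1 {2}GE lead_coefZ.
have szM : size M = size G by rewrite {1}GE size_scale.
have Ma : (map_poly i M).[a] = 0.
  move: Ga; rewrite {1}GE map_polyZ hornerZ => /Ad[/eqP|//].
  by rewrite raddf_eq0 // (negPf l0).
exists M; split=> // F Fa; exists (F %/ M).
rewrite {1}(Pdiv.IdomainMonic.divp_eq Mm F) [X in _ + X]small ?addr0 //.
  have -> : F %% M = F - (F %/ M) * M.
    by rewrite {2}(Pdiv.IdomainMonic.divp_eq Mm F) addrC addKr.
  by rewrite rmorphB rmorphM /= hornerD hornerN hornerM Fa Ma mulr0 subrr.
by rewrite -Gk -szM ltn_modp monic_neq0.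
Qed.

End MinimalPolynomial.

Section LyingOver.
Variables (K : closedFieldType) (D A : comNzRingType).
Variables (f : {rmorphism K -> D}) (i : {rmorphism D -> A}).
Variables (psi : {rmorphism D -> K}).
Hypothesis psif : cancel f psi.
Local Notation AK := (A * K)%type.

Definition graph : {pred AK} :=
  [pred z | `[< exists u, z = (i u, psi u) >]].

Lemma graphP z : reflect (exists u, z = (i u, psi u)) (z \in graph).
Proof. exact: asboolP. Qed.

Fact graph_subring_closed : subring_closed graph.
Proof.
split.
- by apply/graphP; exists 1; rewrite !rmorph1.
- by move=> _ _ /graphP[u ->] /graphP[v ->]; apply/graphP; exists (u - v);
    rewrite !rmorphB.
- by move=> _ _ /graphP[u ->] /graphP[v ->]; apply/graphP; exists (u * v);
    rewrite !rmorphM.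
Qed.

HB.instance Definition _ := GRing.isSubringClosed.Build AK graph
  graph_subring_closed.

Lemma poly_graph (p : {poly AK}) : p \is a polyOver graph ->
  exists G, map_poly fst p = map_poly i G /\ map_poly snd p = map_poly psi G.
Proof.
move=> /polyOverP pG.
have /choice[u uE] j : exists u, p`_j = (i u, psi u) by apply/graphP.
exists (\poly_(j < size p) u j); split; apply/polyP => j;
  (rewrite !coef_map coef_poly; case: ltnP => h /=;
    [by rewrite uE | by rewrite nth_default //= rmorph0]).
Qed.

(** The graph of [psi] is first extended by [(a, t)]: the relations of [a] are multiples of [M],
    which has the root [t]. The integral elements of [xs] are then adjoined one by one with
    [extend_integral]. *)
Lemma lying_over (a : A) (t : K) (M : {poly D}) (xs : seq A) :
  (forall G, (map_poly i G).[a] = 0 -> exists Q, G = Q * M) ->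
  (map_poly psi M).[t] = 0 ->
  (forall x, x \in xs -> integralOver i x) ->
  exists H : subringClosed AK,
    [/\ functional H, forall u, (i u, psi u) \in H, (a, t) \in H &
      forall x, x \in xs -> exists c, (x, c) \in H].
Proof.
move=> Mdvd Mt; elim: xs => [_|x xs IH xsi].
  exists (GRing.SubringClosed.clone _ (adjoin graph (a, t)) _); split=> //.
  - apply: functional_adjoin => p /poly_graph[G [-> ->]] /= /Mdvd[Q ->].
    by rewrite rmorphM hornerM Mt mulr0.
  - by move=> u; apply: adjoin_sub; apply/graphP; exists u.
  - exact: adjoin_gen.
have [y ys|H [Hf Hi Ha Hxs]] := IH.
  by apply: xsi; rewrite inE ys orbT.
have [P Pm /eqP Px] := xsi x (mem_head _ _).
pose h (u : D) : AK := (i u, psi u).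
have hm : monoid_morphism h.
  by split=> [|u v]; rewrite /h ?rmorph1 // !rmorphM.
have ha : zmod_morphism h by move=> u v; rewrite /h !rmorphB.
pose hMix := GRing.isMonoidMorphism.Build _ _ h hm.
pose hAix := GRing.isZmodMorphism.Build _ _ h ha.
pose hh : {rmorphism D -> AK} := HB.pack h hMix hAix.
have [||||w wP] := @extend_integral A K (i \o f) H (map_poly hh P) x _ Hf.
- by move=> c; have := Hi (f c); rewrite psif.
- exact: monic_map.
- by apply/polyOverP => j; rewrite coef_map; exact: Hi.
- have -> : map_poly fst (map_poly hh P) = map_poly i P; last by [].
  by apply/polyP => j; rewrite !coef_map.
exists (GRing.SubringClosed.clone _ (adjoin H (x, w)) _); split=> //.
- by move=> u; apply: adjoin_sub.
- exact: adjoin_sub.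
- move=> y; rewrite inE => /predU1P[->|/Hxs[c cH]].
    by exists w; exact: adjoin_gen.
  by exists c; exact: adjoin_sub.
Qed.

End LyingOver.

(** * Noether normalization *)

Lemma mpoly_rmorph_eq (R A : comNzRingType) n (g h : {rmorphism {mpoly R[n]} ->
  A}) :
  (forall c, g c%:MP = h c%:MP) -> (forall i, g 'X_i = h 'X_i) -> g =1 h.
Proof.
move=> gC gX p; rewrite (mpolyE p) !rmorph_sum; apply: eq_bigr => m _.
rewrite -mul_mpolyC !rmorphM gC mpolyXE_id !rmorph_prod; congr (_ * _).
by apply: eq_bigr => i _; rewrite !rmorphXn gX.
Qed.

Lemma raddf_ker0_inj (U V : zmodType) (g : {additive U -> V}) :
  (forall x, g x = 0 -> x = 0) -> injective g.
Proof.
by move=> g0 x y /eqP; rewrite -subr_eq0 -raddfB => /eqP/g0/subr0_eq.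
Qed.

Section MonicOfDegree.
Variable A : comNzRingType.

Definition monic_deg (p : {poly A}) d := (p \is monic) && (size p == d.+1).

Lemma monic_deg1 : monic_deg 1 0.
Proof. by rewrite /monic_deg monic1 size_poly1. Qed.

Lemma monic_degM p q d e : monic_deg p d -> monic_deg q e ->
  monic_deg (p * q) (d + e).
Proof.
move=> /andP[pm /eqP pd] /andP[qm /eqP qe].
rewrite /monic_deg monicMl // qm size_Mmonic ?monic_neq0 // pd qe.
by rewrite addSn addnS /= eqxx.
Qed.

Lemma monic_degX p d k : monic_deg p d -> monic_deg (p ^+ k) (d * k).
Proof.
move=> pd; elim: k => [|k IH]; first by rewrite expr0 muln0 monic_deg1.
by rewrite exprS mulnS monic_degM.
Qed.

Lemma monic_deg_prod n (F : 'I_n -> {poly A}) (d : 'I_n -> nat) :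
  (forall i, monic_deg (F i) (d i)) ->
  monic_deg (\prod_i F i) (\sum_i d i)%N.
Proof.
move=> Fd; elim/big_ind2 : _ => //; first exact: monic_deg1.
by move=> *; exact: monic_degM.
Qed.

(** Only one term has the largest degree, by injectivity of [d] on [s], so nothing cancels its
    leading coefficient. *)
Lemma monic_deg_sum (I : eqType) (s : seq I) (F : I -> {poly A}) (d : I -> nat)
    (c : I -> A) :
  uniq s -> {in s &, injective d} -> (forall i, monic_deg (F i) (d i)) ->
  s != [::] -> let p : {poly A} := (\sum_(j <- s) c j *: F j)%R in
  exists2 i, i \in s & p`_(d i) = c i /\ (size p <= (d i).+1)%N.
Proof.
move=> su dinj Fd s0 /=.
have [i0 i0s] : exists i, i \in s by case: s s0 {su dinj} => // i s _; exists i;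
  rewrite mem_head.
have exd : exists k, has (fun i => d i == k) s.
  by exists (d i0); apply/hasP; exists i0.
have bnd k : has (fun i => d i == k) s -> (k <= \max_(i <- s) d i)%N.
  by move=> /hasP[i ins /eqP <-]; rewrite leq_bigmax_seq.
have [k /hasP[i ins /eqP dik] kmax] := ex_maxnP exd bnd.
have le_di j : j \in s -> (d j <= d i)%N.
  by move=> js; rewrite dik; apply: kmax; apply/hasP; exists j.
exists i => //; split.
  rewrite coef_sum (bigD1_seq i) //= big_seq_cond big1 => [|j /andP[js ji]].
    have /andP[/monicP + /eqP di] := Fd i; rewrite lead_coefE di /= => Fdi.
    by rewrite coefZ Fdi mulr1 addr0.
  rewrite coefZ nth_default ?mulr0 //.
  have /andP[_ /eqP ->] := Fd j.
  rewrite ltn_neqAle le_di // andbT.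
  by apply: contraNneq ji => /dinj ->.
rewrite big_seq; elim/big_ind : _ => [|p q ps qs|j js].
- by rewrite size_poly0.
- by rewrite (leq_trans (size_polyD _ _)) // geq_max ps qs.
- rewrite (leq_trans (size_scale_leq _ _)) //.
  by have /andP[_ /eqP ->] := Fd j; rewrite ltnS le_di.
Qed.

End MonicOfDegree.

Lemma digits_inj n r (a b : 'I_n -> nat) :
  (forall i, a i < r)%N -> (forall i, b i < r)%N ->
  (\sum_i a i * r ^ i = \sum_i b i * r ^ i)%N -> a =1 b.
Proof.
elim: n a b => [|n IH] a b ar br; first by move=> _ [].
have r0 : (0 < r)%N by apply: leq_trans (ar ord0).
have shift (c : 'I_n.+1 -> nat) : (\sum_i c i * r ^ i =
    c ord0 + (\sum_(i < n) c (lift ord0 i) * r ^ i) * r)%N.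
  rewrite big_ord_recl expn0 muln1 big_distrl /=; congr (_ + _)%N.
  by apply: eq_bigr => i _; rewrite -mulnA -expnSr.
rewrite !shift => e.
have e0 : a ord0 = b ord0.
  have := congr1 (modn^~ r) e.
  by rewrite /= ![(_ + _ * r)%N]addnC !modnMDl !modn_small.
move: e => /eqP; rewrite e0 eqn_add2l eqn_pmul2r // => /eqP.
move=> /(IH (fun i => a (lift ord0 i)) (fun i => b (lift ord0 i))
  (fun i => ar _) (fun i => br _)) h i.
by have [j ->|->] := unliftP ord0 i; [exact: h|].
Qed.

Section NoetherNormalization.
Variables (K : numClosedFieldType) (A : comNzRingType) (iota : {rmorphism K -> A}).

Definition alg_range k (z : 'I_k -> A) (a : A) := exists p, a = mmap iota z p.

Definition integral_over d (y : 'I_d -> A) : {pred A} :=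
  [pred a | `[< integralOver (mmap iota y) a >]].

Section IntegralOver.
Variables (d : nat) (y : 'I_d -> A).

Lemma integral_overP a : reflect (integralOver (mmap iota y) a) (a \in
  integral_over y).
Proof. exact: asboolP. Qed.

Fact integral_over_subring_closed : subring_closed (integral_over y).
Proof.
split.
- by apply/integral_overP; exact: integral1.
- move=> a b /integral_overP ai /integral_overP bi; apply/integral_overP.
  exact: integral_sub.
- move=> a b /integral_overP ai /integral_overP bi; apply/integral_overP.
  exact: integral_mul.
Qed.

HB.instance Definition _ := GRing.isSubringClosed.Build A (integral_over y)
  integral_over_subring_closed.

Lemma integral_over_const c : iota c \in integral_over y.
Proof. by apply/integral_overP; rewrite -(mmapC y iota c); exact: integral_id. Qed.

End IntegralOver.

(* Nagata's change of variables: if [G] annihilates [z], then [z_0] is integral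
   over the [z_(i+1) - z_0 ^ (r ^ (i+1))] for [r] large, because the monomials
   of [G] then become monic polynomials in [z_0] of distinct degrees. *)
Lemma nagata_integral d (y : 'I_d -> A) k (z : 'I_k.+1 -> A) (G : {mpoly
  K[k.+1]}) r :
  G != 0 -> mmap iota z G = 0 -> (msize G <= r)%N -> (0 < r)%N ->
  (forall i : 'I_k, z (lift ord0 i) - z ord0 ^+ (r ^ i.+1) \in integral_over y) ->
  z ord0 \in integral_over y.
Proof.
move=> G0 Gz szG r0 zint.
pose z' (i : 'I_k) := z (lift ord0 i) - z ord0 ^+ (r ^ i.+1).
(* [B i] expresses [z i] as a polynomial in [z ord0] with coefficients integral over [y]. *)
pose B (i : 'I_k.+1) : {poly A} :=
  if unlift ord0 i is Some j then 'X^(r ^ j.+1) + (z' j)%:P else 'X.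
have Bdeg (i : 'I_k.+1) : monic_deg (B i) (r ^ i).
  rewrite /B; have [j ->|->] := unliftP ord0 i; last first.
    by rewrite /monic_deg monicX size_polyX expn0.
  have rj : (0 < r ^ j.+1)%N by rewrite expn_gt0 r0.
  by rewrite /monic_deg size_XnaddC // monicXnaddC ?eqxx.
have Bz (i : 'I_k.+1) : (B i).[z ord0] = z i.
  rewrite /B; have [j ->|->] := unliftP ord0 i; last by rewrite hornerX.
  by rewrite hornerD hornerXn hornerC /z' addrC subrK.
pose F (m : 'X_{1..k.+1}) := \prod_i B i ^+ m i.
pose wt (m : 'X_{1..k.+1}) := (\sum_i m i * r ^ i)%N.
have Fdeg m : monic_deg (F m) (wt m).
  rewrite /wt; under eq_bigr do rewrite mulnC.
  by apply: monic_deg_prod => i; apply: monic_degX.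
(* Exponents below [r] are base-[r] digits, so that [wt] determines the monomial. *)
have mr m i : m \in msupp G -> (m i < r)%N.
  move=> mG; apply: leq_trans szG; apply: leq_ltn_trans (msize_mdeg_lt mG).
  by rewrite mdegE (bigD1 i) //= leq_addr.
have wtinj : {in msupp G &, injective wt}.
  move=> m1 m2 m1G m2G /digits_inj e; apply/mnmP => i.
  by apply: e => j; exact: mr.
have [|m mG] := @monic_deg_sum A _ (msupp G) F wt (fun m => iota G@_m)
  (msupp_uniq G) wtinj Fdeg.
  by rewrite msupp_eq0.
set H := \sum_(j <- _) _ => - [Hm szH].
have Gm : G@_m != 0 by rewrite -mcoeff_msupp.
pose H' := iota (G@_m)^-1 *: H.
have H'm : H' \is monic.
  have H'c : H'`_(wt m) = 1 by rewrite coefZ Hm -rmorphM mulVf ?rmorph1.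
  rewrite monicE lead_coefE; suff -> : size H' = (wt m).+1 by rewrite /= H'c.
  apply/eqP; rewrite eqn_leq (leq_trans (size_scale_leq _ _) szH) /= ltnNge.
  by apply: contra_eqN H'c => h; rewrite nth_default // eq_sym oner_neq0.
have H'z : root H' (z ord0).
  suff Hz : H.[z ord0] = 0 by rewrite /root hornerZ Hz mulr0.
  rewrite -Gz horner_sum; apply: eq_bigr => m' _; rewrite hornerZ horner_prod.
  by congr (_ * _); apply: eq_bigr => i _; rewrite horner_exp Bz.
have Bint i : B i \is a polyOver (integral_over y).
  rewrite /B; case: unlift => [j|]; last exact: polyOverX.
  by rewrite polyOverXnaddC; exact: zint.
apply/integral_overP/(integral_root_monic H'm H'z)/integral_poly => j.
apply/integral_overP; move: j; apply/polyOverP.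
rewrite polyOverZ ?integral_over_const // rpred_sum // => m' _.
by rewrite polyOverZ ?integral_over_const // rpred_prod // => i _; rewrite rpredX.
Qed.

(** Algebraically independent generators serve as [y]. Otherwise Nagata's change of variables leaves
    [k] elements [z'], to which the induction applies, and the [k.+1] old generators are integral
    over the resulting [y]. *)
Lemma noether_normalization k (z : 'I_k -> A) :
  exists d (y : 'I_d -> A), [/\ forall i, alg_range z (y i),
    injective (mmap iota y) & forall i, integralOver (mmap iota y) (z i)].
Proof.
elim: k z => [|k IH] z.
  exists 0%N, z; split=> [[]//||[]//].
  apply: raddf_ker0_inj => p /=.
  by rewrite (nvar0_mpolyC p) mmapC => /eqP; rewrite fmorph_eq0 => /eqP ->.
have [zinj|zdep] := pselect (forall p, mmap iota z p = 0 -> p = 0).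
  exists k.+1, z; split=> [i||i]; last 2 first.
  - exact: raddf_ker0_inj.
  - by rewrite -(mmap1U z i) -(mmapX z iota); exact: integral_id.
  by exists 'X_i; rewrite mmapX mmap1U.
have [G [G0 Gz]] : exists G, G != 0 /\ mmap iota z G = 0.
  have /existsNP[G /not_implyP[Gz /eqP G0]] := zdep; by exists G.
pose r := msize G.
have r0 : (0 < r)%N by rewrite lt0n mmeasure_poly_eq0.
pose t (i : 'I_k) : {mpoly K[k.+1]} := 'X_(lift ord0 i) - 'X_ord0 ^+ (r ^ i.+1).
pose z' (i : 'I_k) := z (lift ord0 i) - z ord0 ^+ (r ^ i.+1).
have [d [y [yrange yinj yint]]] := IH z'.
have z'int i : z' i \in integral_over y by apply/integral_overP; exact: yint.
have z0int := nagata_integral G0 Gz (leqnn r) r0 z'int.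
exists d, y; split=> // i.
  have [p ->] := yrange i; exists (mmap (@mpolyC _ K) t p).
  apply: (@mpoly_rmorph_eq _ _ _ (mmap iota z') (mmap iota z \o mmap (@mpolyC _
    K) t)).
    by move=> c; rewrite /= !mmapC.
  by move=> j; rewrite /= !mmapX !mmap1U rmorphB rmorphXn /= !mmapX !mmap1U.
apply/integral_overP; have [j ->|->//] := unliftP ord0 i.
rewrite -[z _](subrK (z ord0 ^+ (r ^ j.+1))) rpredD ?rpredX //.
exact: z'int.
Qed.

End NoetherNormalization.

(** * Perturbation of roots *)

Section Perturbation.
Variable K : numClosedFieldType.
Implicit Types (f g : {poly K}) (c e : K).

(** This stands in for a minimum: [K] is only partially ordered, but positive elements are real,
    hence comparable. *)
Lemma pos_lower_bound (I : eqType) (s : seq I) (g : I -> K) :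
  (forall i, 0 < g i) -> exists2 e, 0 < e & forall i, i \in s -> e <= g i.
Proof.
move=> g0; elim: s => [|i s [e e0 IH]]; first by exists 1.
have [le_ge|lt_eg] := real_leP (gtr0_real (g0 i)) (gtr0_real e0).
  exists (g i) => // j; rewrite inE => /predU1P[->//|/IH]; exact: le_trans.
exists e => // j; rewrite inE => /predU1P[->|/IH//]; exact: ltW.
Qed.

(** The norm of a monic polynomial at [c] is the product of the distances from [c] to its roots,
    which cannot all be at least [e]. *)
Lemma near_root f c e : f \is monic -> 0 < e -> `|f.[c]| < e ^+ (size f).-1 ->
  exists2 r, root f r & `|c - r| < e.
Proof.
move=> fm e0; have [rs fE] := closed_field_poly_normal f.
rewrite (monicP fm) scale1r in fE.
have szf : (size f).-1 = size rs by rewrite fE size_prod_XsubC.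
move=> fc; apply: contrapT => h; move: fc; rewrite szf {1}fE horner_prod.
have : forall r, r \in rs -> e <= `|c - r|.
  move=> r rrs; rewrite real_leNgt ?(gtr0_real e0) ?normr_real //.
  by apply/negP => cr; apply: h; exists r => //; rewrite fE root_prod_XsubC.
elim: (rs) => [|x s IH] h'; first by rewrite big_nil expr0 normr1 ltxx.
rewrite big_cons !hornerE exprS normrM => lt; apply: IH => [r' r's|].
  by apply: h'; rewrite inE r's orbT.
have ex := h' x (mem_head _ _).
rewrite -(ltr_pM2l e0) (le_lt_trans _ lt) //.
by rewrite ler_wpM2r.
Qed.

Lemma horner_diff_le f g c N : (size f <= N)%N -> (size g <= N)%N ->
  forall e, (forall j, `|f`_j - g`_j| <= e) ->
  `|f.[c] - g.[c]| <= e * \sum_(j < N) `|c| ^+ j.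
Proof.
move=> fN gN e fg; rewrite (horner_coef_wide _ fN) (horner_coef_wide _ gN).
rewrite -sumrB (le_trans (ler_norm_sum _ _ _)) // mulr_sumr ler_sum // => j _.
by rewrite -mulrBl normrM normrX ler_wpM2r ?exprn_ge0.
Qed.

Definition poly_near f e g :=
  [/\ g \is monic, size g = size f & forall j, `|g`_j - f`_j| < e].

Lemma root_perturb f c e : f \is monic -> root f c -> 0 < e ->
  exists2 d, 0 < d & forall g, poly_near f d g ->
    exists2 r, root g r & `|c - r| < e.
Proof.
move=> fm /eqP fc e0; set n := (size f).-1.
pose S := \sum_(j < size f) `|c| ^+ j.
have S0 : 0 <= S by rewrite sumr_ge0 // => j _; rewrite exprn_ge0.
have S1 : 0 < S + 1 by rewrite ltr_wpDl.
(* As [f.[c] = 0], this bounds [g.[c]] by [e ^+ n * S / (S + 1)], strictly below the threshold of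
   [near_root]; the [+ 1] also avoids dividing by zero. *)
exists (e ^+ n / (S + 1)); first by rewrite divr_gt0 ?exprn_gt0.
move=> g [gm sz gf]; apply: near_root => //; rewrite sz -/n.
have := @horner_diff_le g f c (size f) _ (leqnn _) (e ^+ n / (S + 1)).
rewrite fc subr0 sz leqnn => /(_ isT) h.
apply: le_lt_trans (h _) _ => [j|]; first exact: ltW.
by rewrite -/S mulrAC ltr_pdivrMr // ltr_pM2l ?exprn_gt0 // ltrDl.
Qed.

(** If [c] has norm above 1, isolate the leading term in [f.[c] = 0] and divide by the next lower
    power of the norm. *)
Lemma monic_root_bound f c : f \is monic -> root f c ->
  `|c| <= 1 + \sum_(j < size f) `|f`_j|.
Proof.
move=> fm /eqP fc.
have S0 : 0 <= \sum_(j < size f) `|f`_j| by rewrite sumr_ge0.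
have [c1|c1] := real_leP (normr_real c) (real1 K); first by rewrite ler_wpDr.
case sz : (size f) => [|n].
  by move/eqP: sz; rewrite size_poly_eq0 (negPf (monic_neq0 fm)).
move: fc; rewrite horner_coef sz big_ord_recr /=.
have -> : f`_n = 1 by have := monicP fm; rewrite lead_coefE sz.
rewrite mul1r => /eqP; rewrite addrC addr_eq0 => /eqP /(congr1 Num.norm).
rewrite normrN normrX => cn.
case: n sz cn => [|n] sz cn.
  by move: cn; rewrite big_ord0 normr0 expr0 => /eqP; rewrite oner_eq0.
rewrite ler_wpDl // big_ord_recr /= ler_wpDr //.
have c0 : 0 < `|c| ^+ n by rewrite exprn_gt0 // (lt_trans ltr01).
rewrite -(ler_pM2r c0) -exprS cn (le_trans (ler_norm_sum _ _ _)) //.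
rewrite mulr_suml ler_sum // => j _; rewrite normrM normrX ler_wpM2l //.
by rewrite ler_weXn2l ?ltW // -ltnS.
Qed.

Lemma root_perturb_rev f e : f \is monic -> 0 < e ->
  exists2 d, 0 < d & forall g, poly_near f d g -> forall c, root g c ->
    exists2 r, root f r & `|c - r| < e.
Proof.
move=> fm e0; set n := (size f).-1.
(* With [d <= 1], each coefficient of [g] exceeds that of [f] by at most 1 in norm, so [B] bounds
   the roots of all admissible [g] uniformly. *)
pose B := 1 + \sum_(j < size f) (`|f`_j| + 1).
have B0 : 0 <= B by rewrite addr_ge0 ?sumr_ge0 // => j _; rewrite addr_ge0.
pose S := \sum_(j < size f) B ^+ j.
have S0 : 0 <= S by rewrite sumr_ge0 // => j _; rewrite exprn_ge0.
have S1 : 0 < S + 1 by rewrite ltr_wpDl.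
have d0 : 0 < e ^+ n / (S + 1) by rewrite divr_gt0 ?exprn_gt0.
have [d dd0 dle] := @pos_lower_bound bool [:: true; false]
  (fun b => if b then e ^+ n / (S + 1) else 1) (ltac:(by case)).
have dS := dle true (mem_head _ _); have d1 : d <= 1 by apply: (dle false).
exists d => // g [gm sz gf] c gc; apply: near_root => //; rewrite -/n.
have cB : `|c| <= B.
  rewrite (le_trans (monic_root_bound gm gc)) // lerD2l sz ler_sum // => j _.
  rewrite -lerBlDl (le_trans (lerB_dist _ _)) //.
  by rewrite (le_trans (ltW (gf j))).
have := @horner_diff_le g f c (size f) _ (leqnn _) d.
rewrite (eqP gc) sub0r normrN sz leqnn => /(_ isT) h.
apply: le_lt_trans (h _) _ => [j|]; first exact: ltW.
apply: (@le_lt_trans _ _ (e ^+ n / (S + 1) * S)).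
  apply: ler_pM => //; first exact: ltW.
    by rewrite sumr_ge0 // => j _; rewrite exprn_ge0.
  by rewrite ler_sum // => j _; rewrite lerXn2r ?nnegrE.
by rewrite mulrAC ltr_pdivrMr // ltr_pM2l ?exprn_gt0 // ltrDl.
Qed.

End Perturbation.

(** * Continuity of polynomial evaluation *)

Section NearPoint.
Variables (K : numClosedFieldType) (d : nat).
Implicit Types (a b : 'I_d -> K) (P Q : ('I_d -> K) -> Prop).

Definition near_pt a P :=
  exists2 e : K, 0 < e & forall b, (forall i, `|b i - a i| < e) -> P b.

Lemma near_pt_forall (I : finType) a (P : I -> ('I_d -> K) -> Prop) :
  (forall i, near_pt a (P i)) -> near_pt a (fun b => forall i, P i b).
Proof.
move=> /(_ _)/cid2 h.
have [e e0 le] := pos_lower_bound (enum I) (fun i => s2valP (h i)).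
exists e => // b be i; apply: (s2valP' (h i)) => j.
by apply: lt_le_trans (be j) _; apply: le; rewrite mem_enum.
Qed.

Lemma near_ptI a P Q : near_pt a P -> near_pt a Q -> near_pt a (fun b => P b /\ Q
  b).
Proof.
move=> aP aQ; have [|e e0 h] := @near_pt_forall bool a (fun t => if t then P else
  Q).
  by case.
by exists e => // b /h hb; split; [exact: (hb true) | exact: (hb false)].
Qed.

Lemma near_ptS a P Q : (forall b, P b -> Q b) -> near_pt a P -> near_pt a Q.
Proof. by move=> PQ [e e0 h]; exists e => // b /h/PQ. Qed.

Lemma near_mevalM a (u v : {mpoly K[d]}) :
  (forall e, 0 < e -> near_pt a (fun b => `|u.@[b] - u.@[a]| < e)) ->
  (forall e, 0 < e -> near_pt a (fun b => `|v.@[b] - v.@[a]| < e)) ->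
  forall e, 0 < e -> near_pt a (fun b => `|(u * v).@[b] - (u * v).@[a]| < e).
Proof.
move=> hu hv e e0; pose C := `|u.@[a]| + `|v.@[a]| + 1.
have C0 : 0 < C by rewrite ltr_wpDl // addr_ge0.
have [e1 e10 le1] := @pos_lower_bound _ bool [:: true; false]
  (fun t : bool => if t then e / C else 1) (ltac:(by case; rewrite ?divr_gt0)).
have e1C := le1 true (mem_head _ _); have e11 : e1 <= 1 by apply: (le1 false).
apply: near_ptS (near_ptI (hu _ e10) (hv _ e10)) => b [ub vb].
rewrite !mevalM (_ : _ - _ = u.@[b] * (v.@[b] - v.@[a])
  + (u.@[b] - u.@[a]) * v.@[a]); last by ring.
have uB : `|u.@[b]| <= `|u.@[a]| + 1.
  rewrite -lerBlDl (le_trans (lerB_dist _ _)) //.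
  by rewrite (le_trans (ltW ub)).
rewrite (le_lt_trans (ler_normD _ _)) // !normrM.
apply: (@lt_le_trans _ _ ((`|u.@[a]| + 1) * e1 + e1 * `|v.@[a]|)).
  rewrite ltr_leD //; last by rewrite ler_wpM2r // ltW.
  apply: (@le_lt_trans _ _ ((`|u.@[a]| + 1) * `|v.@[b] - v.@[a]|)).
    by rewrite ler_wpM2r.
  by rewrite ltr_pM2l // ltr_wpDl.
rewrite (_ : _ + _ = e1 * C); last by rewrite /C; ring.
by rewrite -ler_pdivlMr.
Qed.

Lemma near_meval a (u : {mpoly K[d]}) (e : K) : 0 < e ->
  near_pt a (fun b => `|u.@[b] - u.@[a]| < e).
Proof.
move: e; have nC c e : 0 < e -> near_pt a (fun b => `|(c%:MP_[d]).@[b] -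
  c%:MP.@[a]| < e).
  by move=> e0; exists 1 => // b _; rewrite !mevalC subrr normr0.
rewrite (mpolyE u); elim/big_ind : _ => [e|p q IHp IHq e e0|m _].
- by rewrite -mpolyC0; exact: nC.
- have e20 : 0 < e / 2 by rewrite divr_gt0.
  apply: near_ptS (near_ptI (IHp _ e20) (IHq _ e20)) => b [hp hq].
  rewrite !mevalD opprD addrACA (le_lt_trans (ler_normD _ _)) //.
  by rewrite [e]splitr ltrD.
rewrite -mul_mpolyC; apply: near_mevalM; first exact: nC.
rewrite mpolyXE_id; elim/big_ind : _ => [|p q IHp IHq|i _].
- by rewrite -mpolyC1; exact: nC.
- exact: near_mevalM.
- elim: (m i) => [|k IH]; first by rewrite expr0 -mpolyC1; exact: nC.
  rewrite exprS; apply: near_mevalM => // e e0.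
  by exists e => // b; rewrite !mevalXU.
Qed.

Lemma near_map_poly a (F : {poly {mpoly K[d]}}) (e : K) : 0 < e -> F \is monic ->
  near_pt a (fun b => poly_near (map_poly (meval a) F) e (map_poly (meval b) F)).
Proof.
move=> e0 Fm.
have szF b : size (map_poly (meval b) F) = size F.
  by rewrite size_map_poly_id0 // (monicP Fm) meval1 oner_neq0.
have := @near_pt_forall 'I_(size F) a _ (fun j => near_meval a F`_j e0).
apply: near_ptS => b h; split; rewrite ?szF //; first exact: monic_map.
move=> j; rewrite !coef_map /=; have [lt_j|le_j] := ltnP j (size F).
  exact: (h (Ordinal lt_j)).
by rewrite nth_default // !meval0 subrr normr0.
Qed.

End NearPoint.

(** * Norm density in Zariski closures *)

(** Divide ['X] out of a monic relation while its constant coefficient is zero, as [a != 0] allows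
    in a domain. Wherever the resulting constant coefficient is nonzero, [a] cannot take the value
    0. *)
Lemma integral_nonzero_const (D A : comNzRingType) (i : {rmorphism D -> A}) (a :
  A) :
  domain A -> a != 0 -> integralOver i a ->
  exists F : {poly D}, F`_0 != 0 /\ (map_poly i F).[a] = 0.
Proof.
move=> Ad a0 [P Pm /eqP Pa].
have P0 := monic_neq0 Pm.
elim: {P Pm}(size P) {-2}P (leqnn (size P)) P0 Pa => [|k IH] P szP P0 Pa.
  by move: szP; rewrite leqn0 size_poly_eq0 (negPf P0).
have [c0|c0] := eqVneq P`_0 0; last by exists P.
have [Q QE] : exists Q, P = Q * 'X.
  have /factor_theorem[Q] : root P 0 by rewrite /root horner_coef0 c0.
  by rewrite subr0; exists Q.
have Q0 : Q != 0 by apply: contraNneq P0 => Q0; rewrite QE Q0 mul0r.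
apply: (IH Q) => //.
  by move: szP; rewrite QE size_mulX // ltnS.
move: Pa; rewrite QE rmorphM /= map_polyX hornerM hornerX => /Ad[//|a00].
by rewrite a00 eqxx in a0.
Qed.

Section PartialMorphismRange.
Variables (K : closedFieldType) (A : comNzRingType) (H : subringClosed (A *
  K)%type).

Lemma mem_mmap n (iota : {rmorphism K -> A}) (x : 'I_n -> A) (c : 'I_n -> K) p :
  (forall k, (iota k, k) \in H) -> (forall i, (x i, c i) \in H) ->
  (mmap iota x p, p.@[c]) \in H.
Proof.
move=> Hk Hx; rewrite (mpolyE p); elim/big_ind : _ => [|q r qH rH|m _].
- by rewrite mmap0 meval0 -[(_, _)]/(0 : A * K) rpred0.
- by rewrite mmapD mevalD -[(_, _)]/((mmap iota x q, q.@[c]) + (mmap iota x r,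
    r.@[c])) rpredD.
rewrite mmapZ mevalZ -[(_, _)]/((iota p@_m, p@_m) * (mmap iota x 'X_[m],
  'X_[m].@[c])).
rewrite rpredM // mmapX mevalX /mmap1; elim/big_ind2 : _ => [|q q' r r' qH rH|i _].
- by rewrite -[(_, _)]/(1 : A * K) rpred1.
- by rewrite -[(_, _)]/((q', q) * (r', r)) rpredM.
suff -> : (x i ^+ m i, c i ^+ m i) = (x i, c i) ^+ m i by rewrite rpredX.
elim: (m i) => [|k IH]; first by rewrite !expr0.
by rewrite !exprS -IH.
Qed.

Lemma mem_horner (D : nzRingType) (i : {rmorphism D -> A}) (psi : {rmorphism D ->
  K})
    (x : A) (c : K) (F : {poly D}) :
  (forall u, (i u, psi u) \in H) -> (x, c) \in H ->
  ((map_poly i F).[x], (map_poly psi F).[c]) \in H.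
Proof.
move=> Hi Hx; elim/poly_ind: F => [|F u IH].
  by rewrite !rmorph0 !horner0 -[(_, _)]/(0 : A * K) rpred0.
rewrite !rmorphD !rmorphM /= !map_polyX !map_polyC !hornerMXaddC.
rewrite -[(_, _)]/(((map_poly i F).[x], (map_poly psi F).[c]) * (x, c) + (i u,
  psi u)).
by rewrite rpredD // rpredM.
Qed.

End PartialMorphismRange.

(** * Separating linear forms *)

Section Separation.
Variable K : numClosedFieldType.

(** Read [v i] as the coefficients of a polynomial [p i], and choose [s] outside the roots of all
    nonzero [p i]. *)
Lemma finite_separation (I : finType) n (v : I -> 'I_n -> K) :
  exists s : K, forall i, (\sum_(k < n) s ^+ k * v i k = 0) -> forall k, v i k = 0.
Proof.
pose p i : {poly K} := \poly_(k < n) (if insub k is Some k' then v i k' else 0).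
have pE i s : (p i).[s] = \sum_(k < n) s ^+ k * v i k.
  by rewrite horner_poly; apply: eq_bigr => k _; rewrite valK mulrC.
have [s sP] := @poly_neq0_nonroot K K idfun (\prod_(i | p i != 0) p i)
  (ltac:(by apply/prodf_neq0)).
exists s => i e k; have [p0|p0] := eqVneq (p i) 0.
  have := congr1 (fun q : {poly K} => q`_k) p0.
  by rewrite coef_poly ltn_ord valK coef0.
by move: sP; rewrite horner_prod => /prodf_neq0/(_ i p0)/eqP; rewrite pE e.
Qed.

(** Let [h] be a lower bound for the norms of the nonzero values of the form at grid points minus
    [x0]. For a grid point near [c] the value is below [h], hence 0, so by the choice of [s] this
    grid point is [x0]. *)
Lemma grid_separation n (rs : 'I_n -> seq K) (x0 : 'I_n -> K) (e : K) : 0 < e ->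
  exists s : K, exists2 e' : K, 0 < e' & forall c : 'I_n -> K,
    (forall k, exists2 r, r \in rs k & `|c k - r| < e') ->
    `|\sum_(k < n) s ^+ k * (c k - x0 k)| < e' -> forall k, `|c k - x0 k| < e.
Proof.
move=> e0; pose N := (\max_k size (rs k)).+1.
(* The default 0 of [nth] may add points to the grid, which stays finite. *)
pose pt (g : {ffun 'I_n -> 'I_N}) k := nth 0 (rs k) (g k) - x0 k.
have [s sP] := finite_separation pt.
pose val g := \sum_(k < n) s ^+ k * pt g k.
have vpos g : 0 < (if val g == 0 then 1 else `|val g|).
  by case: ifPn => // ?; rewrite normr_gt0.
have [h h0 hle] := pos_lower_bound (enum {ffun 'I_n -> 'I_N}) vpos.
pose S := 1 + \sum_(k < n) `|s| ^+ k.
have S0 : 0 < S.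
  by rewrite ltr_wpDr // sumr_ge0 // => k _; rewrite exprn_ge0.
have [e' e'0 e'le] := @pos_lower_bound _ bool [:: true; false]
  (fun t : bool => if t then h / S else e) (ltac:(by case; rewrite ?divr_gt0)).
have e'h := e'le true (mem_head _ _); have e'e : e' <= e by apply: (e'le false).
exists s, e' => // c /(_ _)/cid2 r cs k.
have idx j : exists i : 'I_N, nth 0 (rs j) i = s2val (r j).
  have rin := s2valP (r j).
  have lt_i : (index (s2val (r j)) (rs j) < N)%N.
    rewrite ltnS (leq_trans (ltnW _) (leq_bigmax j)) // index_mem //.
  by exists (Ordinal lt_i); rewrite nth_index.
pose g := [ffun j => projT1 (cid (idx j))].
have gE j : pt g j = s2val (r j) - x0 j.
  by rewrite /pt ffunE (projT2 (cid (idx j))).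
have val0 : val g = 0.
  apply/eqP/negPn/negP => vn0.
  have := hle g; rewrite mem_enum (negPf vn0) => /(_ isT).
  rewrite real_leNgt ?normr_real ?gtr0_real // => /negP; apply.
  apply: (@lt_le_trans _ _ (e' * S)); last by rewrite -ler_pdivlMr.
  have -> : val g = \sum_(j < n) s ^+ j * (c j - x0 j) - \sum_(j < n) s ^+ j * (c
    j - s2val (r j)).
    rewrite -sumrB; apply: eq_bigr => j _; rewrite gE; ring.
  rewrite (le_lt_trans (ler_normB _ _)) // mulrDr mulr1 ltr_leD //.
  rewrite (le_trans (ler_norm_sum _ _ _)) // mulr_sumr ler_sum // => j _.
  by rewrite normrM normrX mulrC ler_wpM2r ?exprn_ge0 // ltW // (s2valP' (r j)).
have /(_ k) := sP g val0; rewrite gE => /subr0_eq <-.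
by rewrite (lt_le_trans (s2valP' (r k))).
Qed.

End Separation.

Section LocalDensity.
Variables (K : numClosedFieldType) (n : nat) (A : comNzRingType).
Variables (ev : {rmorphism {mpoly K[n]} -> A}) (x0 : 'I_n -> K).
Hypotheses (Ad : domain A) (ev_x0 : forall p, ev p = 0 -> p.@[x0] = 0).

(* [x0] is a point of the variety with coordinate ring [ev], and [T] is the
   separating linear form, with value 0 at [x0]; the point [c] comes from a root
   near 0 of the minimal polynomial [M] of [T], specialized at a point [b] near
   the projection of [x0]. *)
Lemma domain_local_density (q : {mpoly K[n]}) (e : K) : ev q != 0 -> 0 < e ->
  exists c : 'I_n -> K, [/\ forall p, ev p = 0 -> p.@[c] = 0,
    forall k, `|c k - x0 k| < e & q.@[c] != 0].
Proof.
move=> evq e0.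
pose iota : {rmorphism K -> A} := ev \o @mpolyC n K.
pose x k := ev 'X_k.
have evE p : ev p = mmap iota x p.
  apply: (@mpoly_rmorph_eq _ _ _ ev (mmap iota x)) => [c|i] /=.
    by rewrite mmapC.
  by rewrite mmapX mmap1U.
have [d [y [yrange yinj yint]]] := noether_normalization iota x.
have {yrange}/choice[Y YE] k : exists p, y k = ev p.
  by have [p ->] := yrange k; exists p; rewrite evE.
pose i : {rmorphism {mpoly K[d]} -> A} := mmap iota y.
pose j : {rmorphism {mpoly K[d]} -> {mpoly K[n]}} := mmap (@mpolyC n K) Y.
have iE u : i u = ev (j u).
  apply: (@mpoly_rmorph_eq _ _ _ i (ev \o j)) => [c|k] /=.
    by rewrite /i /j /= !mmapC.
  by rewrite /i /j /= !mmapX !mmap1U.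
(* [a] is the projection of [x0] to the normalizing coordinates. *)
pose a k := (Y k).@[x0].
have aE u : (j u).@[x0] = u.@[a].
  apply: (@mpoly_rmorph_eq _ _ _ (meval x0 \o j) (meval a)) => [c|k] /=.
    by rewrite /j /= mmapC !mevalC.
  by rewrite /j /= mmapX mmap1U mevalXU.
have int_ev p : integralOver i (ev p).
  have xint k : x k \in integral_over iota y by apply/integral_overP/yint.
  apply/(@integral_overP _ _ iota _ y); rewrite evE /mmap rpred_sum // => m _.
  rewrite rpredM ?integral_over_const // /mmap1 rpred_prod // => k _.
  by rewrite rpredX.
have /choice[F /all_and2[Fm Fx]] k : exists F : {poly {mpoly K[d]}},
    F \is monic /\ (map_poly i F).[x k] = 0.
  by have [F Fm /eqP Fx] := yint k; exists F.
(* The constant coefficient of this relation of [q] is nonzero; a [b] off its zeros will give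
   [q.@[c] != 0]. *)
have [g [g0 gq]] := integral_nonzero_const Ad evq (int_ev q).
pose f k := map_poly (meval a) (F k).
have fm k : f k \is monic by apply: monic_map.
pose rs k := sval (closed_field_poly_normal (f k)).
have rsP k r : root (f k) r -> r \in rs k.
  rewrite /rs; case: closed_field_poly_normal => s /= ->.
  by rewrite (monicP (fm k)) scale1r root_prod_XsubC.
have [s [e' e'0 sep]] := grid_separation rs x0 e0.
pose T : {mpoly K[n]} := \sum_(k < n) (s ^+ k)%:MP * ('X_k - (x0 k)%:MP).
have TE c : T.@[c] = \sum_(k < n) s ^+ k * (c k - x0 k).
  rewrite /T rmorph_sum; apply: eq_bigr => k _ /=.
  by rewrite mevalM mevalB !mevalC mevalXU.
have [M [Mm MT Mdvd]] := integral_minpoly Ad yinj (@gauss_property_mpoly K d)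
  (int_ev T).
(* The relation [M] of [T] in [A] lifts to a polynomial that vanishes at [x0], where [T] is 0. *)
have M0 : root (map_poly (meval a) M) 0.
  have jM : ev (map_poly j M).[T] = 0.
    rewrite -horner_map -map_poly_comp -[RHS]MT; congr (_.[_]).
    by apply/polyP => l; rewrite !coef_map_id0 ?rmorph0 //= -iE.
  have := ev_x0 jM; rewrite -horner_map -map_poly_comp /= TE big1 => [|k _];
    last first.
    by rewrite subrr mulr0.
  move=> h; apply/eqP; rewrite -[RHS]h; congr (_.[_]).
  by apply/polyP => l; rewrite !coef_map_id0 ?rmorph0 //= aE.
have [d1 d10 near1] := root_perturb (monic_map (meval a) Mm) M0 e'0.
have near2 k : exists2 dk, 0 < dk & forall h, poly_near (f k) dk h ->
    forall c, root h c -> exists2 r, root (f k) r & `|c - r| < e'.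
  exact: root_perturb_rev.
have [b [bM bF] gb] : exists2 b, poly_near (map_poly (meval a) M) d1 (map_poly
  (meval b) M) /\
    (forall k h, root (map_poly (meval b) (F k)) h ->
       exists2 r, root (f k) r & `|h - r| < e') & (g`_0).@[b] != 0.
  have nearF : near_pt a (fun b => forall k h, root (map_poly (meval b) (F k)) h ->
       exists2 r, root (f k) r & `|h - r| < e').
    apply: near_pt_forall => k; have [dk dk0 h] := near2 k.
    by apply: near_ptS (near_map_poly a dk0 (Fm k)) => b /h.
  have [h h0 hP] := near_ptI (near_map_poly a d10 Mm) nearF.
  by have [b /hP bP gb] := near_mpoly_neq0 a g0 h0; exists b.
have [t tM t0] := near1 _ bM.
have evalC : cancel (@mpolyC d K) (meval b) by move=> u; rewrite mevalC.
(* Evaluation at [b], with [T] sent to [t], extends to the coordinates [x k]; their images make up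
   [c]. *)
have [|H [Hf Hi Ht Hx]] := @lying_over K _ A _ i _ evalC _ t M (codom x)
  Mdvd (eqP tM).
  by move=> _ /codomP[k ->]; exact: yint.
have /choice[c cH] k : exists c, (x k, c) \in H by apply: Hx; exact: codom_f.
have Hk k : (iota k, k) \in H.
  suff <- : (i k%:MP, k%:MP.@[b]) = (iota k, k) by exact: Hi.
  by rewrite mevalC /i /= mmapC.
have Hev p : (ev p, p.@[c]) \in H by rewrite evE; exact: mem_mmap.
exists c; split.
- by move=> p evp; apply: Hf; rewrite -evp.
- apply: sep => [k|].
    have cF : root (map_poly (meval b) (F k)) (c k).
      have := mem_horner (F k) Hi (cH k); rewrite Fx => /Hf; exact: introT eqP.
    by have [r /rsP rrs cr] := bF k _ cF; exists r.
  rewrite -TE (functional_eq Hf (Hev T) Ht).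
  by move: t0; rewrite sub0r normrN.
- apply: contraNneq gb => qc.
  have := mem_horner g Hi (Hev q); rewrite gq => /Hf.
  by rewrite qc horner_coef0 coef_map /= => ->.
Qed.

End LocalDensity.

Local Open Scope classical_set_scope.

(** * Noetherian rings and prime ideals *)

Definition is_ideal (R : comNzRingType) (I : set R) :=
  [/\ I 0, forall x y, I x -> I y -> I (x + y) & forall a x, I x -> I (a * x)].

(* Being generated by [s] is expressed as being contained in every ideal that
   contains [s]. *)
Definition noetherian (R : comNzRingType) :=
  forall I : set R, is_ideal I -> exists2 s : seq R, {in s, forall x, I x} &
    forall J, is_ideal J -> {in s, forall x, J x} -> I `<=` J.

Lemma noetherian_field (F : fieldType) : noetherian F.
Proof.
move=> I [I0 ID IM]; have [[x [Ix x0]]|h] := pselect (exists x, I x /\ x != 0).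
  exists [:: x] => [y|J [_ _ JM] Jx y _]; first by rewrite inE => /eqP ->.
  by rewrite -[y](divfK x0); apply: JM; apply: Jx; rewrite mem_head.
exists [::] => // J [J0 _ _] _ x Ix.
have [->//|x0] := eqVneq x 0.
by case: h; exists x.
Qed.

Lemma noetherian_iso (R S : comNzRingType) (f : {rmorphism S -> R}) :
  bijective f -> noetherian R -> noetherian S.
Proof.
move=> [g fK gK] noethR I idI.
have image_ideal (J : set S) : is_ideal J -> is_ideal [set r | J (g r)].
  move=> [J0 JD JM]; split=> /= [|x y Jx Jy|a x Jx].
  - by rewrite -(rmorph0 f) fK.
  - by rewrite -(gK x) -(gK y) -rmorphD fK; exact: JD.
  - by rewrite -(gK x) -(gK a) -rmorphM fK; exact: JM.
have [s Is sgen] := noethR _ (image_ideal I idI).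
exists (map g s) => [_ /mapP[x xs ->]|J idJ Js x Ix]; first exact: Is.
rewrite -(fK x); apply: (sgen _ (image_ideal J idJ)) => /= [y ys|].
  by apply: Js; exact: map_f.
by rewrite fK.
Qed.

(** Leading coefficients of the members of [I] of degree [k], together with 0: bounding the size
    instead of fixing it is what makes this an ideal. *)
Definition coef_ideal (R : comNzRingType) (I : set {poly R}) k : set R :=
  [set a | exists p, [/\ I p, (size p <= k.+1)%N & p`_k = a]].

Section CoefIdeal.
Variables (R : comNzRingType) (I : set {poly R}).
Hypothesis idI : is_ideal I.

Lemma coef_ideal_ideal k : is_ideal (coef_ideal I k).
Proof.
have [I0 ID IM] := idI;
  split=> [|_ _ [p [Ip sp <-]] [q [Iq sq <-]]|a _ [p [Ip sp <-]]].
- by exists 0; rewrite size_poly0 coef0.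
- exists (p + q); split; [exact: ID| |by rewrite coefD].
  by rewrite (leq_trans (size_polyD _ _)) // geq_max sp.
- exists (a%:P * p); split; [exact: IM| |by rewrite coefCM].
  by rewrite mul_polyC (leq_trans (size_scale_leq _ _)).
Qed.

Lemma coef_ideal_mono k l : (k <= l)%N -> coef_ideal I k `<=` coef_ideal I l.
Proof.
have [I0 ID IM] := idI; move=> kl _ [p [Ip sp <-]].
exists ('X^(l - k) * p); split; [exact: IM| |].
  rewrite mulrC (leq_trans (size_polyMleq _ _)) // size_polyXn addnS /=.
  by rewrite -[in leqRHS](subnKC kl) -addSn leq_add2r.
by rewrite coefXnM ltnNge leq_subr /= subKn.
Qed.

End CoefIdeal.

(** The increasing union of the [coef_ideal I k] is finitely generated, so they are constant from
    some [N] on. Lifts of generators of those up to [N] generate [I]: subtracting a suitable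
    combination lowers the size of any member. *)
Lemma hilbert_basis (R : comNzRingType) : noetherian R -> noetherian {poly R}.
Proof.
move=> noethR I idI; have [I0 ID IM] := idI.
have idk k := coef_ideal_ideal idI k.
pose L : set R := [set a | exists k, coef_ideal I k a].
have idL : is_ideal L.
  split=> [|x y [k kx] [l ly]|a x [k kx]].
  - by exists 0%N; have [] := idk 0%N.
  - exists (maxn k l); have [_ D _] := idk (maxn k l).
    by apply: D; [move: kx|move: ly]; apply: coef_ideal_mono => //;
      rewrite (leq_maxl, leq_maxr).
  - by exists k; have [_ _ M] := idk k; exact: M.
have [t Lt tgen] := noethR L idL.
have [N LN] : exists N, {in t, forall x, coef_ideal I N x}.
  elim: t Lt {tgen} => [|x t IH] Lt; first by exists 0%N.
  have [|N HN] := IH; first by move=> y yt; apply: Lt; rewrite inE yt orbT.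
  have [k kx] := Lt x (mem_head _ _).
  exists (maxn k N) => y; rewrite inE => /predU1P[->|/HN].
    by apply: coef_ideal_mono kx => //; rewrite leq_maxl.
  by apply: coef_ideal_mono => //; rewrite leq_maxr.
have {tgen Lt LN}LN k : coef_ideal I k `<=` coef_ideal I N.
  by move=> x kx; apply: (tgen _ (idk N) LN); exists k.
have /choice[s /all_and2[sI sgen]] k : exists s : seq {poly R},
    {in s, forall p, I p} /\ forall J, is_ideal J -> {in s, forall p, J p} ->
      coef_ideal I k `<=` coef_ideal J k.
  have [u uk ugen] := noethR _ (idk k).
  have /choice[P PP] a : exists p, a \in u -> [/\ I p, (size p <= k.+1)%N & p`_k
    = a].
    by have [/uk[p pP]|] := boolP (a \in u); [exists p | exists 0].
  exists (map P u); split=> [_ /mapP[a au ->]|J idJ Js];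
    first by have [] := PP a au.
  apply: (ugen _ (coef_ideal_ideal idJ k)) => a au.
  by have [? ? ?] := PP a au; exists (P a); split=> //; apply: Js; exact: map_f.
exists (flatten (map s (iota 0 N.+1))) => [p /flatten_mapP[k _ /sI]//|J idJ Js].
have [J0 JD JM] := idJ.
(* Intersecting with [I] ensures that what is subtracted from [p] lies in [I], so that the induction
   applies to the difference. *)
pose JI := J `&` I.
have idJI : is_ideal JI.
  split=> [|x y [Jx Ix] [Jy Iy]|b x [Jx Ix]]; first by [].
    by split; [exact: JD | exact: ID].
  by split; [exact: JM | exact: IM].
have sJ k : coef_ideal I k `<=` coef_ideal JI k.
  have small l : (l <= N)%N -> coef_ideal I l `<=` coef_ideal JI l.
    move=> lN; apply: sgen => // p ps; split; last exact: sI ps.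
    by apply: Js; apply/flatten_mapP; exists l; rewrite ?mem_iota.
  have [/small//|Nk] := leqP k N.
  move=> a /LN/(small N (leqnn N)); apply: coef_ideal_mono => //.
  exact: ltnW.
move=> p; elim: {p}(size p) {-2}p (leqnn (size p)) => [|k IH] p szp Ip.
  by move: szp; rewrite leqn0 size_poly_eq0 => /eqP ->.
have [|r [[Jr Ir] szr rk]] := sJ k p`_k; first by exists p.
rewrite -[p](subrK r); apply: JD => //; apply: IH.
  apply/leq_sizeP => j; rewrite leq_eqVlt => /predU1P[<-|kj].
    by rewrite coefB rk subrr.
  by rewrite coefB !nth_default ?subrr // (leq_trans _ kj).
by apply: ID => //; rewrite -mulN1r; exact: IM.
Qed.

Lemma noetherian_mpoly (K : fieldType) n : noetherian {mpoly K[n]}.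
Proof.
elim: n => [|n IH]; last exact: noetherian_iso (muni_bij K n) (hilbert_basis IH).
apply: (@noetherian_iso K _ (meval (fun=> 0))); last exact: noetherian_field.
exists (@mpolyC 0 K) => [p|c]; last exact: mevalC.
by have := nvar0_mpolyC p; set c := _@__ => ->; rewrite /= mevalC.
Qed.

(** Take [P] maximal among the ideals that contain [I] and miss [S]. If [x] and [y] are outside [P],
    adjoining either one to [P] gives an ideal meeting [S]; with [x * y] in [P], the product of two
    such elements of [S] would lie in [P]. *)
Lemma prime_avoidance (R : comNzRingType) (I S : set R) :
  is_ideal I -> S 1 -> (forall x y, S x -> S y -> S (x * y)) ->
  (forall x, I x -> ~ S x) ->
  exists P : set R, [/\ is_ideal P, I `<=` P, forall x, P x -> ~ S x &
    forall x y, P (x * y) -> P x \/ P y].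
Proof.
move=> idI S1 SM IS; have [I0 ID IM] := idI.
pose good (B : set R) := [/\ is_ideal B, I `<=` B & forall x, B x -> ~ S x].
have [|P [gP Pmax]] := @Zorn_bigcup R [set B | B = set0 \/ good B].
  move=> F Fgood Ftot.
  have [[B [FB [b Bb]]]|F0] := pselect (exists B, F B /\ B !=set0); last first.
    left; rewrite -subset0 => x [B FB Bx]; apply: F0.
    by exists B; split=> //; exists x.
  have goodF C x : F C -> C x -> good C.
    by move=> FC Cx; have [C0|//] := Fgood C FC; rewrite C0 in Cx.
  have [[B0 BD BM] IB BS] := goodF B b FB Bb.
  right; split=> [|x Ix|x [C FC Cx]]; last by have [_ _] := goodF C x FC Cx; exact.
  - split=> [|x y [C FC Cx] [C' FC' C'y]|a x [C FC Cx]]; first by exists B.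
    + have [[_ CD _] _ _] := goodF C x FC Cx.
      have [[_ CD' _] _ _] := goodF C' y FC' C'y.
      have [CC'|C'C] := Ftot _ _ FC FC'.
        by exists C' => //; apply: CD' => //; exact: CC'.
      by exists C => //; apply: CD => //; exact: C'C.
    + have [[_ _ CM] _ _] := goodF C x FC Cx.
      by exists C => //; exact: CM.
  - by exists B => //; exact: IB.
have {}gP : good P.
  case: gP => // P0; exfalso; apply: (Pmax I); last by right; split.
  rewrite P0; split; first exact: sub0set.
  by move=> /(_ 0 I0).
have [[P0 PD PM] IP PS] := gP; exists P; split=> // x y Pxy.
apply: contrapT => /not_orP[Px Py].
have meets z : ~ P z -> exists p a, P p /\ S (p + a * z).
  move=> Pz; apply: contrapT => h.
  apply: (Pmax [set w | exists p a, P p /\ w = p + a * z]).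
    split=> [w Pw|]; first by exists w, 0; rewrite mul0r addr0.
    move=> sub; apply: Pz; apply: sub; exists 0, 1.
    by rewrite add0r mul1r.
  right; split=> [|w Iw|w [p [a [Pp ->]]] Sw]; last by apply: h; exists p, a.
  - split=> [|_ _ [p [a [Pp ->]]] [q [b [Pq ->]]]|c _ [p [a [Pp ->]]]].
    + by exists 0, 0; rewrite mul0r addr0.
    + by exists (p + q), (a + b); rewrite mulrDl addrACA; split=> //; exact: PD.
    + by exists (c * p), (c * a); rewrite mulrDr mulrA; split=> //; exact: PM.
  - by exists w, 0; rewrite mul0r addr0; split=> //; exact: IP.
have [p [a [Pp Sp]]] := meets x Px; have [q [b [Pq Sq]]] := meets y Py.
apply: PS (SM _ _ Sp Sq).
have -> : (p + a * x) * (q + b * y) = (q + b * y) * p + ((a * x) * q + (a * b) *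
  (x * y)).
  by ring.
by apply: (PD); [exact: PM | apply: (PD); exact: PM].
Qed.

Lemma prime_quotient (R : comNzRingType) (P : set R) : is_ideal P -> ~ P 1 ->
  (forall x y, P (x * y) -> P x \/ P y) ->
  exists (A : comNzRingType) (g : {rmorphism R -> A}),
    domain A /\ forall x, g x = 0 <-> P x.
Proof.
move=> [P0 PD PM] P1 Pprime.
pose Pb : R -> bool := fun x => `[< P x >].
have Pcl : idealr_closed Pb.
  split; [exact/asboolP | exact/asboolP | move=> a x y /asboolP Px /asboolP Py].
  by apply/asboolP/PD => //; exact: PM.
pose idm := isIdealr.Build R Pb Pcl.
pose I : idealr R := HB.pack Pb idm.
exists {ideal_quot I}, (\pi_({ideal_quot I})%qT : {rmorphism R -> {ideal_quot I}}).
have piP (x : R) : (\pi_({ideal_quot I})%qT x = 0) <-> P x.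
  have -> : (\pi_({ideal_quot I})%qT x = 0) <-> (\pi_({ideal_quot I})%qT x == 0).
    by split=> /eqP.
  by rewrite !piE Quotient.equivE subr0; split=> /asboolP.
split=> // x y; rewrite -[x]reprK -[y]reprK -rmorphM => /piP/Pprime.
by case=> /piP ->; [left|right].
Qed.

(* A Zariski locally closed set is dense, for the norm topology, in its Zariski
   closure. *)
Lemma locally_closed_density (K : numClosedFieldType) n (T S : set {mpoly K[n]})
    (x0 : 'I_n -> K) (e : K) :
  let U := [set x : 'I_n -> K | (forall t, T t -> t.@[x] = 0) /\
                                exists2 s, S s & s.@[x] != 0] in
  (forall p : {mpoly K[n]}, (forall x, U x -> p.@[x] = 0) -> p.@[x0] = 0) ->
  0 < e -> exists2 c, U c & forall k, `|c k - x0 k| < e.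
Proof.
move=> U clU e0.
pose I : set {mpoly K[n]} := [set p | forall x, U x -> p.@[x] = 0].
have idI : is_ideal I.
  split=> [x _|p q Ip Iq x Ux|p q Iq x Ux]; first exact: meval0.
    by rewrite mevalD Ip // Iq // addr0.
  by rewrite mevalM Iq // mulr0.
have [I0 ID IM] := idI.
(* The contraction of the localization of [I] at [x0]. *)
pose Iloc := [set p : {mpoly K[n]} | exists2 h, h.@[x0] != 0 & I (h * p)].
have idIloc : is_ideal Iloc.
  split=> [|p q [h h0 Ihp] [k k0 Ikq]|p q [h h0 Ihq]].
  - by exists 1; rewrite ?meval1 ?oner_neq0 // mulr0.
  - exists (h * k); first by rewrite mevalM mulf_neq0.
    have -> : h * k * (p + q) = k * (h * p) + h * (k * q) by ring.
    by apply: ID; exact: IM.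
  - by exists h => //; rewrite mulrCA; exact: IM.
(* If [Iloc] contained [S], finite generation would give one [h], nonzero at [x0], with all [h * s]
   in [I]. Each point of [U] has some [s] nonzero there, so [h] would vanish on [U], hence at
   [x0]. *)
have [s Ss sloc] : exists2 s, S s & ~ Iloc s.
  apply: contrapT => noS.
  have SIloc s : S s -> Iloc s by move=> Ss; apply: contrapT => h; apply: noS;
    exists s.
  have [gs gsI gsgen] := noetherian_mpoly idIloc.
  have [h h0 hgs] : exists2 h, h.@[x0] != 0 & {in gs, forall g, I (h * g)}.
    elim: gs gsI {gsgen} => [|g gs IH] gsI; first by exists 1;
      rewrite ?meval1 ?oner_neq0.
    have [k k0 Ikg] := gsI g (mem_head _ _).
    have [|h h0 hgs] := IH; first by move=> g' g'gs; apply: gsI;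
      rewrite inE g'gs orbT.
    exists (h * k); first by rewrite mevalM mulf_neq0.
    move=> g'; rewrite inE => /predU1P[->|/hgs Ihg'].
      by rewrite -mulrA; exact: IM.
    by rewrite mulrAC mulrC; exact: IM.
  have idh : is_ideal [set p | I (h * p)].
    split=> [|p q Ip Iq|p q Iq] /=; first by rewrite mulr0.
      by rewrite mulrDr; exact: ID.
    by rewrite mulrCA; exact: IM.
  have /eqP := h0; apply; apply: clU => x Ux; have [_ [s Ss sx]] := Ux.
  have /(_ x Ux)/eqP := gsgen _ idh hgs s (SIloc s Ss).
  by rewrite mevalM mulf_eq0 (negPf sx) orbF => /eqP.
(* [P] corresponds to an irreducible closed subset of the closure of [U], through [x0], on which [s]
   is not identically zero. *)
have [|x y|p|P [idP IP PS Pprime]] :=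
  prime_avoidance (S := [set p | exists2 h, h.@[x0] != 0 & exists k, p = h * s ^+
    k]) idI.
- by exists 1; rewrite ?meval1 ?oner_neq0 //; exists 0%N; rewrite expr0 mulr1.
- move=> [h h0 [k ->]] [h' h'0 [k' ->]]; exists (h * h').
    by rewrite mevalM mulf_neq0.
  by exists (k + k')%N; rewrite exprD; ring.
- move=> Ip [h h0 [k pE]]; apply: sloc; exists h => // z Uz.
  have /eqP := Ip z Uz; rewrite pE !mevalM rmorphXn mulf_eq0 expf_eq0 /=.
  by case/orP => [/eqP ->|/andP[_ /eqP ->]]; rewrite ?mul0r ?mulr0.
have Ps0 p h k : P p -> h.@[x0] != 0 -> p <> h * s ^+ k.
  by move=> Pp h0 pE; apply: (PS p Pp); exists h => //; exists k.
have P1 : ~ P 1.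
  by move=> /(Ps0 _ 1 0%N); rewrite meval1 oner_neq0 mulr1; apply.
have [A [g [Ad gP]]] := prime_quotient idP P1 Pprime.
have [||c [cP cx0 sc]] := @domain_local_density K n A g x0 Ad _ s e _ e0.
- move=> p /gP Pp; apply/eqP/negPn/negP => p0.
  by apply: (Ps0 p p 0%N) => //; rewrite mulr1.
- apply/eqP => /gP Ps; apply: (Ps0 s 1 1%N) => //; last by rewrite mul1r.
  by rewrite meval1 oner_neq0.
exists c => //; split=> [t Tt|]; last by exists s.
by apply/cP/gP/IP => x [+ _]; exact.
Qed.

(** * Functions with a Zariski closed graph *)

Section GenericFormula.
Variables (K : numClosedFieldType) (n : nat).
Implicit Types (Q : {poly {mpoly K[n]}}) (v w : 'rV[K]_n).

Definition peval_poly v Q : {poly K} := map_poly (meval (fun i => v ord0 i)) Q.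

Lemma coef_peval_poly v Q k : (peval_poly v Q)`_k = peval Q`_k v.
Proof. by rewrite coef_map. Qed.

Variables (V : set 'rV[K]_n) (g : V -> K).

Definition vanishes_over (h : {mpoly K[n]}) Q :=
  forall y : V, peval h (set_val y) != 0 -> (peval_poly (set_val y) Q).[g y] = 0.

(** Zariski closedness of the graph of [g] in [V * K]; [vanishes_over 1] asks for a relation valid
    on all of [V]. *)
Definition separated_graph := forall (x : V) s, s != g x ->
  exists2 Q, vanishes_over 1 Q & (peval_poly (set_val x) Q).[s] != 0.

Lemma vanishes_overM h k Q : vanishes_over h Q -> vanishes_over (h * k) Q.
Proof.
by move=> hQ y; rewrite /peval mevalM mulf_eq0 negb_or => /andP[/hQ].
Qed.

Lemma vanishes_over1 h Q : vanishes_over 1 Q -> vanishes_over h Q.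
Proof. by move=> Q1 y _; apply: Q1; rewrite /peval meval1 oner_neq0. Qed.

(* Dropping the leading terms whose coefficient vanishes over [{h != 0}]. *)
Lemma nonzero_lead h Q : vanishes_over h Q ->
  (exists y : V, peval h (set_val y) != 0 /\ peval_poly (set_val y) Q != 0) ->
  exists h' Q', [/\ (size Q' <= size Q)%N, vanishes_over (h * h') Q',
    exists y : V, peval (h * h') (set_val y) != 0 &
    forall y : V, peval (h * h') (set_val y) != 0 ->
      peval (lead_coef Q') (set_val y) != 0].
Proof.
elim: {Q}(size Q) {-2}Q (leqnn (size Q)) => [|k IH] Q szQ hQ [y [hy Qy]].
  by move: szQ Qy; rewrite leqn0 size_poly_eq0 => /eqP ->;
    rewrite /peval_poly rmorph0 eqxx.
have [[z [hz lz]]|nol] := pselect (exists z : V,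
    peval h (set_val z) != 0 /\ peval (lead_coef Q) (set_val z) != 0).
  exists (lead_coef Q), Q; split=> //.
  - exact: vanishes_overM.
  - by exists z; rewrite /peval mevalM mulf_neq0.
  - by move=> w; rewrite /peval mevalM mulf_eq0 negb_or => /andP[].
pose m := (size Q).-1; pose Q' := Q - lead_coef Q *: 'X^m.
have Q'E (z : V) : peval h (set_val z) != 0 -> peval_poly (set_val z) Q' =
  peval_poly (set_val z) Q.
  move=> hz; have lz : peval (lead_coef Q) (set_val z) = 0.
    by apply/eqP/negPn/negP => lz; apply: nol; exists z.
  by rewrite /peval_poly rmorphB /= map_polyZ /= -[_.@[_]]/(peval _ _) lz scale0r
    subr0.
have Q0 : Q != 0 by apply: contraNneq Qy => ->; rewrite /peval_poly rmorph0.
have szQ' : (size Q' <= m)%N.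
  apply/leq_sizeP => j; rewrite leq_eqVlt => /predU1P[<-|mj].
    by rewrite coefB coefZ coefXn eqxx mulr1 -lead_coefE subrr.
  rewrite coefB coefZ coefXn (gtn_eqF mj) mulr0 subr0 nth_default //.
  by rewrite polySpred.
have [|||h' [Q'' [sz van ex lead]]] := IH Q'.
- by rewrite (leq_trans szQ') // -ltnS -polySpred.
- by move=> z hz; rewrite Q'E // hQ.
- by exists y; rewrite Q'E.
exists h', Q''; split=> //.
by rewrite (leq_trans sz) // (leq_trans szQ') // leq_pred.
Qed.

(** Such a [p] is a constant times the [m]-th power of ['X - a]; compare the coefficients of degree
    [m - 1]. *)
Lemma single_root_formula (p : {poly K}) a : p != 0 -> p.[a] = 0 ->
  (forall s, p.[s] = 0 -> s = a) ->
  let m := (size p).-1 in a = - p`_m.-1 / (m%:R * lead_coef p) /\ m%:R *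
    lead_coef p != 0.
Proof.
move=> p0 pa pu m; have [rs pE] := closed_field_poly_normal p.
have l0 : lead_coef p != 0 by rewrite lead_coef_eq0.
have szrs : size rs = m by rewrite /m pE size_scale // size_prod_XsubC.
have rsa r : r \in rs -> r = a.
  move=> rrs; apply: pu; apply/eqP; rewrite pE hornerZ mulf_eq0.
  by rewrite -[(\prod_(_ <- _) _).[_] == 0]/(root _ _) root_prod_XsubC rrs orbT.
have m0 : m != 0%N.
  apply/negP => /eqP m0; have rs0 : rs = [::] by apply: size0nil; rewrite szrs.
  by move/eqP: pa; rewrite pE rs0 big_nil hornerZ hornerC mulr1 (negPf l0).
have ml0 : m%:R * lead_coef p != 0 by rewrite mulf_neq0 // pnatr_eq0.
split=> //; apply/eqP; rewrite -(inj_eq (mulIf ml0)) divfK //; apply/eqP.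
rewrite [in RHS]pE coefZ -szrs coefPn_prod_XsubC ?szrs //.
have -> : \sum_(z <- rs) z = m%:R * a.
  rewrite (eq_big_seq (fun=> a)) => [|r /rsa//].
  by rewrite big_const_seq count_predT szrs iter_addr addr0 mulr_natl.
by ring.
Qed.

(* The relation [Q] of minimal degree divides, up to a power of its leading
   coefficient, all the other ones; since these separate the graph, [g y] is the
   only root of [Q] over [y]. *)
Lemma generic_formula h (w : V) : separated_graph -> peval h (set_val w) != 0 ->
  exists h' p q, (exists y : V, peval (h * h') (set_val y) != 0) /\
    forall y : V, peval (h * h') (set_val y) != 0 ->
      peval q (set_val y) != 0 /\ g y = peval p (set_val y) / peval q (set_val y).
Proof.
move=> sep hw.
pose good d := exists h' Q, [/\ size Q = d, vanishes_over (h * h') Q,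
  exists y : V, peval (h * h') (set_val y) != 0 &
  forall y : V, peval (h * h') (set_val y) != 0 ->
    peval (lead_coef Q) (set_val y) != 0].
have exgood : exists d, `[< good d >].
  have [|Q Q1 Qs] := sep w (g w + 1).
    by rewrite -subr_eq0 addrAC subrr add0r oner_neq0.
  have [||h' [Q' [_ hQ' ex lead]]] := @nonzero_lead h Q.
  - exact: vanishes_over1.
  - by exists w; split=> //; apply: contraNneq Qs => ->; rewrite horner0.
  by exists (size Q'); apply/asboolP; exists h', Q'.
have [d /asboolP[h' [Q [szQ hQ [y0 hy0] lead]]] dmin] := ex_minnP exgood.
(* Otherwise [nonzero_lead] would turn [r] into a good relation of size below the minimum [d]. *)
have small (r : {poly {mpoly K[n]}}) (y : V) : vanishes_over (h * h') r ->
    (size r < d)%N -> peval (h * h') (set_val y) != 0 -> peval_poly (set_val y) r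
      = 0.
  move=> hr szr hy; apply/eqP/negPn/negP => r0.
  have [|h2 [r' [szr' hr' ex lead']]] := nonzero_lead hr; first by exists y.
  have : (d <= size r')%N.
    by apply: dmin; apply/asboolP; exists (h' * h2), r'; rewrite mulrA.
  by rewrite leqNgt (leq_ltn_trans szr').
exists h', (- Q`_(size Q).-2), ((size Q).-1%:R * lead_coef Q).
split=> [|y hy]; first by exists y0.
have ly := lead y hy.
have szy : size (peval_poly (set_val y) Q) = size Q by rewrite size_map_poly_id0.
have lcy : lead_coef (peval_poly (set_val y) Q) = peval (lead_coef Q) (set_val y).
  by rewrite lead_coef_map_eq.
have [||s Qs|aE q0] := @single_root_formula (peval_poly (set_val y) Q) (g y).
- by rewrite -lead_coef_eq0 lcy.
- exact: hQ.
- apply/eqP/negPn/negP => /sep[Q2 Q21 /eqP]; apply.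
  have := Pdiv.Idomain.divp_eq Q2 Q; set be := _ ^+ _ => divE.
  have hr : vanishes_over (h * h') (Q2 %% Q).
    move=> z hz; have -> : Q2 %% Q = be *: Q2 - (Q2 %/ Q) * Q by rewrite divE
      addrC addKr.
    rewrite /peval_poly rmorphB /= map_polyZ rmorphM /= hornerD hornerN hornerZ
      hornerM.
    have := hQ z hz; have := vanishes_over1 Q21 hz.
    by rewrite /peval_poly => -> ->; rewrite !mulr0 subrr.
  have r0 : peval_poly (set_val y) (Q2 %% Q) = 0.
    apply: small hr _ hy; rewrite -szQ ltn_modp -lead_coef_eq0.
    by apply: contraNneq ly => ->; rewrite /peval meval0.
  have := congr1 (fun q => (peval_poly (set_val y) q).[s]) divE.
  rewrite /peval_poly rmorphD /= map_polyZ rmorphM /= -!/(peval_poly _ _) r0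
    addr0 hornerZ hornerM Qs mulr0.
  move/eqP; rewrite mulf_eq0 /be rmorphXn expf_eq0 /=.
  by case/orP => [/andP[_ lQ]|/eqP//]; rewrite /peval lQ in ly.
move: aE q0; rewrite szy lcy coef_peval_poly /peval => aE q0.
by rewrite mevalN mevalM rmorph_nat.
Qed.

Lemma separated_graph_rational : separated_graph -> rational_function g.
Proof.
move=> sep.
pose nice (W : set V) := zariski_open_in W /\ exists p q : {mpoly K[n]},
  forall y, W y -> peval q (set_val y) != 0 /\
    g y = peval p (set_val y) / peval q (set_val y).
have basic_open h : zariski_open_in [set y : V | peval h (set_val y) != 0].
  exists (zero_locus [set h]); first by exists [set h].
  apply/seteqP; split=> y /= hy; first by move=> /(_ h erefl) h0;
    rewrite h0 eqxx in hy.
  by apply/eqP => h0; apply: hy => _ ->.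
(* The union of all open sets carrying a formula; it is dense because [generic_formula] finds one
   inside any nonempty open set. *)
pose U : set V := [set y | exists W, nice W /\ W y].
have open_basic W (y : V) : zariski_open_in W -> W y -> exists h,
    peval h (set_val y) != 0 /\ forall z : V, peval h (set_val z) != 0 -> W z.
  move=> [_ [S ->] ->] /= /existsNP[h /not_implyP[Sh /eqP hy]].
  by exists h; split=> // z /eqP hz /(_ h Sh).
exists U; split.
- exists (zero_locus [set h | forall y : V, peval h (set_val y) != 0 -> U y]).
    by exists [set h | forall y : V, peval h (set_val y) != 0 -> U y].
  apply/seteqP; split=> y /=.
    move=> [W [niceW Wy]]; have [h [hy hW]] := open_basic W y niceW.1 Wy.
    by move=> /(_ h)/= h0; move/eqP: hy; apply; apply: h0 => z hz; exists W;
      split=> //; exact: hW.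
  by move=> /existsNP[h /not_implyP[hU /eqP hy]]; exact: hU.
- move=> W Wo [w Ww]; have [h [hw hW]] := open_basic W w Wo Ww.
  have [h' [p [q [[y hy] formula]]]] := generic_formula sep hw.
  exists y; split; last first.
    by apply: hW; move: hy; rewrite /peval mevalM mulf_eq0 negb_or => /andP[].
  exists [set z : V | peval (h * h') (set_val z) != 0]; split=> //.
  by split; [exact: basic_open | exists p, q].
- move=> y [W [[Wo Wpq] Wy]]; exists W; split=> // z Wz.
  by exists W.
Qed.

End GenericFormula.

(** * The graph of a continuous rational function *)

Section ClosedGraph.
Variables (K : numClosedFieldType) (n : nat) (X : set 'rV[K]_n) (f : X -> K).

Definition eps_continuous := forall (x : X) (e : K), 0 < e ->
  exists2 d : K, 0 < d & forall y : X,
    (forall k, `|set_val y ord0 k - set_val x ord0 k| < d) -> `|f y - f x| < e.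

(** The added coordinate comes last, as the variable that [muni] singles out. *)
Definition join_pt (v : 'rV[K]_n) (t : K) (i : 'I_n.+1) : K :=
  if unlift ord_max i is Some j then v ord0 j else t.

Lemma join_pt_max v t : join_pt v t ord_max = t.
Proof. by rewrite /join_pt unlift_none. Qed.

Lemma join_pt_widen v t i : join_pt v t (widen i) = v ord0 i.
Proof.
rewrite /join_pt (_ : widen i = lift ord_max i) ?liftK //.
by apply: val_inj; rewrite /= /bump leqNgt ltn_ord.
Qed.

Lemma join_pt_near (v w : 'rV[K]_n) (s t d : K) :
  (forall k, `|v ord0 k - w ord0 k| < d) -> `|s - t| < d ->
  forall i, `|join_pt v s i - join_pt w t i| < d.
Proof. by move=> vw st i; rewrite /join_pt; case: unliftP. Qed.

Lemma meval_join_pt (p : {mpoly K[n.+1]}) v t :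
  p.@[join_pt v t] = (peval_poly v (muni p)).[t].
Proof.
rewrite meval_muni join_pt_max; congr (_.[_]); apply: eq_map_poly => q.
by apply: meval_eq => i; rewrite join_pt_widen.
Qed.

Hypotheses (Xclosed : zariski_closed X) (frat : rational_function f).
Hypothesis fcont : eps_continuous.

Lemma rational_separated_graph : separated_graph f.
Proof.
have [T0 XE] := Xclosed.
have [U [[_ [S0 ->] UE] Udense Ureg]] := frat.
have inX (v : 'rV[K]_n) : (forall t, T0 t -> peval t v = 0) -> exists x : X,
  set_val x = v.
  move=> vT; have vX : v \in X by apply/mem_set; rewrite XE => t /vT.
  by exists (exist _ v vX).
have XT (x : X) t : T0 t -> peval t (set_val x) = 0.
  by move=> Tt; have := set_valP x; rewrite {1}XE; apply.
have UP (x : X) : U x <-> exists2 s, S0 s & peval s (set_val x) != 0.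
  rewrite UE /=; split=> [/existsNP[s /not_implyP[Ss /eqP sx]]|[s Ss /eqP sx] /(_
    s Ss)//].
  by exists s.
have near_U (x : X) (e : K) : 0 < e ->
    exists2 u : X, U u & forall k, `|set_val u ord0 k - set_val x ord0 k| < e.
  move=> e0; have [|c [cT cS] cx] :=
    @locally_closed_density K n T0 S0 (fun k => set_val x ord0 k) e _ e0.
    move=> p pU; apply/eqP/negPn/negP => px.
    have [||y [Uy /=]] := Udense [set y | peval p (set_val y) != 0].
    - exists (zero_locus [set p]); first by exists [set p].
      apply/seteqP; split=> y /= hy; last by apply/eqP => h0; apply: hy => _ ->.
      by move=> /(_ p erefl) h0; rewrite h0 eqxx in hy.
    - by exists x.
    rewrite -/(peval _ _) /peval pU ?eqxx // ; split; first exact: XT.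
    by have /UP := Uy.
  have rE : (fun i => (\row_j c j) ord0 i) = c :> ('I_n -> K) by apply/funext =>
    i; rewrite mxE.
  have [|u uE] := inX (\row_i c i); first by move=> t Tt; rewrite /peval rE cT.
  exists u; last by move=> k; rewrite uE mxE.
  by apply/UP; case: cS => s Ss sc; exists s => //; rewrite uE /peval rE.
move=> x s sfx; apply: contrapT => noQ.
(* [T] and [S] present the graph over [U] as a locally closed set in dimension [n.+1]. *)
pose T : set {mpoly K[n.+1]} :=
  [set p | forall u : X, U u -> p.@[join_pt (set_val u) (f u)] = 0].
pose S : set {mpoly K[n.+1]} := [set p | exists2 s, S0 s & muni p = s%:P].
have muni_mmul (Q : {poly {mpoly K[n]}}) v t : (mmul Q).@[join_pt v t] =
  (peval_poly v Q).[t].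
  by rewrite meval_join_pt mmulK.
have graphU (w : 'I_n.+1 -> K) : (forall p, T p -> p.@[w] = 0) ->
    (exists2 p, S p & p.@[w] != 0) ->
    exists2 u : X, U u & w = join_pt (set_val u) (f u).
  move=> wT wS; pose v := \row_i w (widen i).
  have wE : w = join_pt v (w ord_max).
    apply/funext => i; have [j ->|->] := unliftP ord_max i;
      last by rewrite join_pt_max.
    rewrite (_ : lift ord_max j = widen j) ?join_pt_widen ?mxE //.
    by apply: val_inj; rewrite /= /bump leqNgt ltn_ord.
  move: wE wT wS; set t := w ord_max; move: v t => v t {w}-> wT wS.
  have [|u uv] := inX v.
    move=> p Tp; have := wT (mmul p%:P);
      rewrite muni_mmul /peval_poly map_polyC hornerC.
    by apply=> u _; rewrite muni_mmul /peval_poly map_polyC hornerC; exact: XT.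
  have Uu : U u.
    have [p [q Sq pE] pw] := wS; apply/UP; exists q => //.
    by move: pw; rewrite meval_join_pt pE /peval_poly map_polyC hornerC uv.
  exists u => //; rewrite uv; congr (join_pt _ _).
  have [W [[_ [S' ->] WE] Wu WU [p [q fpq]]]] := Ureg u Uu.
  have [h Sh hu] : exists2 h, S' h & peval h (set_val u) != 0.
    by move: Wu; rewrite WE /= => /existsNP[h /not_implyP[Sh /eqP hu]]; exists h.
  have hW (y : X) : peval h (set_val y) != 0 -> W y.
    by rewrite WE /= => /eqP hy /(_ h Sh).
  (* Where [h] is nonzero this relation says [t = p / q]; the factor [h] makes it hold on the whole
     graph over [U]. *)
  have := wT (mmul (h%:P * (q%:P * 'X - p%:P))).
  have eval v' t' : (peval_poly v' (h%:P * (q%:P * 'X - p%:P))).[t'] =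
      peval h v' * (peval q v' * t' - peval p v').
    rewrite /peval_poly rmorphM rmorphB rmorphM /= !map_polyC map_polyX.
    by rewrite hornerM hornerD hornerN hornerM !hornerC hornerX.
  rewrite muni_mmul eval -uv => /(_ _)/eqP; rewrite mulf_eq0 (negPf hu) /=.
  have [qu ->] := fpq u (hW u hu).
  rewrite subr_eq0 => /(_ _)/eqP e; apply: (mulfI qu); rewrite e.
    by rewrite mulrC divfK.
  move=> y Uy; rewrite muni_mmul eval;
    have [->|hy] := eqVneq (peval h (set_val y)) 0.
    by rewrite mul0r.
  have [qy ->] := fpq y (hW y hy).
  by rewrite mulrCA divff // mulr1 subrr mulr0.
(* Relations on the graph over [U] extend to all of [X] by continuity of [f] and norm density of
   [U]. *)
have vanish (p : {mpoly K[n.+1]}) : T p -> forall y : X, p.@[join_pt (set_val y)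
  (f y)] = 0.
  move=> Tp y; apply/eqP/negPn/negP => py.
  have py0 : 0 < `|p.@[join_pt (set_val y) (f y)]| by rewrite normr_gt0.
  have [d d0 near] := near_meval (join_pt (set_val y) (f y)) p py0.
  have [d' d'0 fnear] := fcont y d0.
  have [d2 d20 d2P] := @pos_lower_bound K bool [:: true; false]
    (fun t : bool => if t then d else d') (ltac:(by case)).
  have [u Uu uy] := near_U y d2 d20.
  have := near (join_pt (set_val u) (f u));
    rewrite Tp // sub0r normrN ltxx => /(_ _)/negP.
  apply=> //; apply: join_pt_near => [k|].
    by apply: lt_le_trans (uy k) _; apply: (d2P true).
  apply: fnear => k.
  by apply: lt_le_trans (uy k) _; apply: (d2P false).
have e0 : 0 < `|s - f x| / 2 by rewrite divr_gt0 // normr_gt0 subr_eq0.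
have [d d0 fnear] := fcont x e0.
have [e' e'0 e'P] := @pos_lower_bound K bool [:: true; false]
  (fun t : bool => if t then `|s - f x| / 2 else d) (ltac:(by case)).
(* If no relation separates it from the graph, [(x, s)] is in the Zariski closure of the graph over
   [U]. A nearby point of that graph has its value within half the distance from [s] to [f x] of
   both, which is absurd. *)
have [|c [cT cS] cx] := @locally_closed_density K n.+1 T S (join_pt (set_val x)
  s) e' _ e'0.
  move=> p pT; rewrite meval_join_pt; apply/eqP/negPn/negP => ps.
  apply: noQ; exists (muni p) => // y _.
  rewrite -meval_join_pt; apply: vanish => u Uu; apply: pT; split=> [q|].
    by apply.
  have /UP[q Sq qu] := Uu; exists (mmul q%:P); first by exists q; rewrite ?mmulK.
  by rewrite muni_mmul /peval_poly map_polyC hornerC.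
have [u Uu cE] := graphU c cT cS.
have fs : `|f u - s| < `|s - f x| / 2.
  have := cx ord_max; rewrite cE !join_pt_max => h.
  by apply: lt_le_trans h _; apply: (e'P true).
have fx : `|f u - f x| < `|s - f x| / 2.
  apply: fnear => k; have := cx (widen k); rewrite cE !join_pt_widen => h.
  by apply: lt_le_trans h _; apply: (e'P false).
have := le_lt_trans (ler_distD (f u) s (f x)) (ltrD _ fx).
by rewrite distrC => /(_ _ fs); rewrite -splitr ltxx.
Qed.

End ClosedGraph.

End SeparatedGraphs.

From mathcomp Require Import all_classical all_reals all_analysis.
From mathcomp Require Import complex.

Local Open Scope classical_set_scope.
Local Open Scope ring_scope.

(** * The norm topology and restriction to a subvariety *)

Section NormTopology.
Import Order.TTheory GRing.Theory Num.Theory.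
Import numFieldNormedType.Exports.
Import SeparatedGraphs.

Set Implicit Arguments.

Lemma continuous_eps (K : numClosedFieldType) n (X : set 'rV[K]_n) (f : X -> K) :
  continuous f -> eps_continuous f.
Proof.
move=> fc x e e0.
have /cvgrPdist_lt/(_ e e0) := fc x.
move=> [_ [[W oW <-] /= Wx sW]].
have /nbhs_ballP[d /= d0 dW] : nbhs (set_val x) W by exact: open_nbhs_nbhs.
exists d => // y xy; rewrite distrC; apply: sW; apply: dW.
split=> // i j; rewrite ord1 /ball /= distrC; exact: xy.
Qed.

Lemma subfun_continuous (T : topologicalType) (A B : set T) (AB : A `<=` B) :
  continuous (subfun AB).
Proof.
move=> x U [_ [[W oW <-] /= Wx sW]].
exists (set_val @^-1` W); split=> //; first by exists W.
by move=> y Wy; apply: sW.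
Qed.

(** A relation valid on the graph of [f] remains valid over [V], so the restriction inherits a
    separated graph. *)
Lemma K0_restriction (K : numClosedFieldType) n (X V : set 'rV[K]_n) (VX : V `<=` X)
    (f : X -> K) :
  zariski_closed X -> K0 X f -> K0 V (f \o subfun VX).
Proof.
move=> Xclosed [frat fcont]; split; last first.
  move=> x; apply: continuous_comp; [exact: subfun_continuous | exact: fcont].
apply: separated_graph_rational => x s sx.
have [Q Q1 Qs] := rational_separated_graph Xclosed frat (continuous_eps fcont) sx.
by exists Q => // y h; apply: (Q1 (subfun VX y)).
Qed.

End NormTopology.

(* [f \o subfun VX] is the restriction of [f] to [V]. *)
Theorem proposition4p14 (R : realType) (n : nat) (X : set 'rV[R[i]]_n)
    (hX : zariski_closed X) (f : X -> R[i]) (hf : K0 X f)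
    (V : set 'rV[R[i]]_n) (hV : zariski_closed V) (VX : V `<=` X) :
  K0 V (f \o subfun VX).
Proof. exact: K0_restriction. Qed.
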